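(* For any non-constant $L_k^p$-map $f \in \mathcal{M}^*$, there exist a small neighbourhood $U_\epsilon(f)$ of $f$ in $\mathcal{M}^*$ and a compact set $K_f \subset G$ such that for any $h \in U_\epsilon(f)$ and any $g \in G \setminus K_f$, the map $h \circ g$ is not in $U_\epsilon(f)$. In particular, for any $g \in G\setminus K_f$, $f\circ g$ is not in $U_\epsilon(f)$.
   Context: $M$ is a compact $C^\infty$-manifold with a Riemannian metric. $\Sigma \simeq S^2 \simeq \mathbf{CP}^1$ with its standard complex structure and round metric. $G_0 \simeq PSL(2,\mathbf{C})$ acts on $\Sigma$ as the group of reparametrizations (Möbius transformations); $G_1$ (resp. $G_2$) is the subgroup of $G_0$ fixing one marked point $x_1$ (resp. each of two distinct marked points $x_1, x_2$) of $\Sigma$. $G$ denotes any one of the three groups $G_0, G_1, G_2$, with its Lie group topology. The Sobolev order $k$ and exponent $p$ are fixed with $k - \frac{2}{p} > 1$. $\mathcal{M} = \mathcal{M}_{k,p}(\Sigma, M)$ is the space of maps $\Sigma \to M$ of Sobolev class $L_k^p$ ($k$ derivatives in $L^p$), with its $L_k^p$-topology, and $\mathcal{M}^* \subset \mathcal{M}$ is the subspace of non-constant maps. $G$ acts on $\mathcal{M}$ by $(g,f) \mapsto f \circ g$. $U_\epsilon(f)$ denotes the open $\epsilon$-neighbourhood of $f$ in the $L_k^p$-norm (measured in exponential coordinates at $f$, or equivalently via an embedding of $M$ into some $\mathbf{R}^m$). *)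

(* Defs.v *)
From HB Require Import structures.
From mathcomp Require Import all_boot all_order all_algebra.
From mathcomp Require Import generic_quotient complex.
From mathcomp Require Import all_classical all_reals all_analysis.

Set Implicit Arguments.
Unset Strict Implicit.
Unset Printing Implicit Defensive.

Import Order.TTheory GRing.Theory Num.Theory.
Import numFieldNormedType.Exports.

Local Open Scope classical_set_scope.
Local Open Scope ring_scope.
Local Open Scope complex_scope.
Local Open Scope quotient_scope.

(* Smoothness between finite-dimensional normed spaces: on an open set [U],
   C^oo means that all iterated directional derivatives exist and are
   continuous. *)
Section smooth.
Context {R : realType} {V W : normedModType R}.

Definition iter_derive (vs : seq V) (f : V -> W) : V -> W :=
  foldr (fun v (g : V -> W) x => 'D_v g x) f vs.

Definition smooth_on (U : set V) (f : V -> W) : Prop :=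
  forall (vs : seq V) (x : V), U x ->
    (forall v, derivable (iter_derive vs f) x v) /\
    {for x, continuous (iter_derive vs f)}.

End smooth.

Section manifold.
Context {R : realType} {n : nat} {M : topologicalType}.

(* [chart_inv] is only meaningful on [chart_codom]. *)
Record chart := Chart {
  chart_dom : set M;
  chart_map : M -> 'rV[R]_n;
  chart_inv : 'rV[R]_n -> M }.

Definition chart_codom (c : chart) : set 'rV[R]_n :=
  chart_map c @` chart_dom c.

Record is_chart (c : chart) : Prop := IsChart {
  chart_dom_open : open (chart_dom c);
  chart_codom_open : open (chart_codom c);
  chart_mapK : {in chart_dom c, cancel (chart_map c) (chart_inv c)};
  chart_map_continuous : {within chart_dom c, continuous (chart_map c)};
  chart_inv_continuous : {within chart_codom c, continuous (chart_inv c)} }.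

Definition overlap (c c' : chart) : set 'rV[R]_n :=
  chart_map c @` (chart_dom c `&` chart_dom c').

Definition transition (c c' : chart) : 'rV[R]_n -> 'rV[R]_n :=
  chart_map c' \o chart_inv c.

End manifold.
Arguments chart : clear implicits.

(* Second countability is not required: it is automatic for compact [M].
   [metric c x] is the Gram matrix of the metric in the chart [c]. *)
Record riemannian_manifold (R : realType) (n : nat) (M : topologicalType) :=
  RiemannianManifold {
  manifold_hausdorff : hausdorff_space M;
  atlas : set (chart R n M);
  atlas_chart : forall c, atlas c -> is_chart c;
  atlas_cover : forall x : M, exists2 c, atlas c & chart_dom c x;
  atlas_smooth : forall c c', atlas c -> atlas c' ->
    smooth_on (overlap c c') (transition c c');
  metric : chart R n M -> 'rV[R]_n -> 'M[R]_n;
  metric_smooth : forall c, atlas c -> smooth_on (chart_codom c) (metric c);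
  metric_sym : forall c x, atlas c -> chart_codom c x ->
    (metric c x)^T = metric c x;
  metric_pos : forall c x (u : 'rV[R]_n), atlas c -> chart_codom c x ->
    u != 0 -> 0 < (u *m metric c x *m u^T) ord0 ord0;
  metric_transition : forall c c' x (u v : 'rV[R]_n),
    atlas c -> atlas c' -> overlap c c' x ->
    u *m metric c x *m v^T =
    'D_u (transition c c') x *m metric c' (transition c c' x)
      *m ('D_v (transition c c') x)^T }.

(* An injective immersion; for compact [M] it is automatically a
   homeomorphism onto its image. *)
Record smooth_embedding (R : realType) (n m : nat) (M : topologicalType)
    (X : riemannian_manifold R n M) (iota : M -> 'rV[R]_m) : Prop :=
  SmoothEmbedding {
  embedding_inj : injective iota;
  embedding_smooth : forall c, atlas X c ->
    smooth_on (chart_codom c) (iota \o chart_inv c);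
  embedding_immersion : forall c x (u : 'rV[R]_n),
    atlas X c -> chart_codom c x -> u != 0 ->
    'D_u (iota \o chart_inv c) x != 0 }.

(* The Riemann sphere CP^1 = C u {oo}; the point oo is [None].  The alias
   [R[i]^o] carries the topology of C. *)
Section sphere.
Context (R : realType).

Definition sphere := one_point_compactification (R[i]^o).

(* The two holomorphic charts C -> CP^1, z |-> z and w |-> 1/w, with
   C = R x R. *)
Definition sphere_chart (i : bool) (z : R * R) : sphere :=
  if i then (if z == (0, 0) then None else Some ((z.1 +i* z.2)^-1))
  else Some (z.1 +i* z.2).

Definition SL2 : set 'M[R[i]^o]_2 := [set A | \det A = 1].

Definition SL2_eqv (A B : SL2) : bool :=
  (\val A == \val B) || (\val A == - \val B).

Lemma SL2_eqv_refl : reflexive SL2_eqv.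
Proof. by move=> A; rewrite /SL2_eqv eqxx. Qed.

Lemma SL2_eqv_sym : symmetric SL2_eqv.
Proof.
by move=> A B; rewrite /SL2_eqv eq_sym; congr (_ || _); rewrite -eqr_oppLR eq_sym.
Qed.

Lemma SL2_eqv_trans : transitive SL2_eqv.
Proof.
move=> B A C; rewrite /SL2_eqv => /orP[]/eqP -> /orP[]/eqP ->;
  by rewrite ?opprK eqxx ?orbT.
Qed.

Canonical SL2_equiv :=
  EquivRel SL2_eqv SL2_eqv_refl SL2_eqv_sym SL2_eqv_trans.

(* PSL(2,C) = SL(2,C)/{1,-1} with the quotient of the matrix topology. *)
Definition PSL2 := quotient_topology {eq_quot SL2_eqv}.

Definition mobius (A : 'M[R[i]^o]_2) (x : sphere) : sphere :=
  let a : R[i] := A 0 0 in let b : R[i] := A 0 1 in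
  let c : R[i] := A 1 0 in let d : R[i] := A 1 1 in
  match x with
  | Some z => let z : R[i] := z in
              if c * z + d == 0 then None else Some ((a * z + b) / (c * z + d))
  | None => if c == 0 then None else Some (a / c)
  end.

Definition reparam (g : PSL2) : sphere -> sphere :=
  mobius (\val (repr (g : {eq_quot SL2_eqv}))).

Lemma mobiusN A : mobius (- A) =1 mobius A.
Proof.
case=> [z|] /=; rewrite !mxE.
  by rewrite !mulNr -!opprD oppr_eq0 invrN mulrNN.
by rewrite oppr_eq0 invrN mulrNN.
Qed.

Lemma reparam_pi (A : SL2) :
  reparam (\pi_{eq_quot SL2_eqv} A) =1 mobius (\val A).
Proof.
move=> x; rewrite /reparam.
have /eqmodP : repr (\pi_{eq_quot SL2_eqv} A) = A %[mod {eq_quot SL2_eqv}].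
  by rewrite reprK.
by rewrite /= /SL2_eqv => /orP[/eqP -> //|/eqP ->]; rewrite mobiusN.
Qed.

Definition stabilizer (x : sphere) : set PSL2 := [set g | reparam g x = x].

Definition reparam_group (G : set PSL2) : Prop :=
  [\/ G = setT,
      exists x1, G = stabilizer x1 |
      exists x1 x2, x1 <> x2 /\ G = stabilizer x1 `&` stabilizer x2].

End sphere.

HB.instance Definition _ (R : realType) := Topological.copy (PSL2 R)
  (quotient_topology {eq_quot (@SL2_eqv R)}).

Section sobolev.
Context {R : realType}.

Definition disc (r : R) : set (R * R) :=
  [set z | z.1 ^+ 2 + z.2 ^+ 2 < r ^+ 2].

Definition lebesgue2 :=
  (@lebesgue_measure R \x @lebesgue_measure R)%E.

Definition Lp_norm_disc (p r : R) (u : R * R -> R) : \bar R :=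
  ('N[lebesgue2]_(p%:E) [EFin \o (u \_ (disc r))])%E.

Definition Lp_loc (p : R) (u : R * R -> R) : Prop :=
  measurable_fun setT u /\ forall r, (Lp_norm_disc p r u < +oo)%E.

Definition partial (a b : nat) (phi : R * R -> R) : R * R -> R :=
  iter_derive (nseq a ((1, 0) : R * R) ++ nseq b ((0, 1) : R * R)) phi.

Definition test_function (phi : R * R -> R) : Prop :=
  smooth_on setT phi /\
  exists r, forall z, ~ disc r z -> phi z = 0.

Definition is_weak_partial (a b : nat) (u v : R * R -> R) : Prop :=
  Lp_loc 1 v /\
  forall phi, test_function phi ->
    (\int[lebesgue2]_z (u z * partial a b phi z) =
     (-1) ^+ (a + b) * \int[lebesgue2]_z (v z * phi z))%R.

(* Weak derivatives are unique almost everywhere, so the choice made by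
   [xget] is immaterial to the norm. *)
Definition weak_partial (a b : nat) (u : R * R -> R) : R * R -> R :=
  xget (fun=> 0) [set v | is_weak_partial a b u v].

Definition sobolev_loc (k : nat) (p : R) (u : R * R -> R) : Prop :=
  forall a b, (a + b <= k)%N ->
    exists2 v, is_weak_partial a b u v & Lp_loc p v.

Definition sobolev_norm_disc (k : nat) (p r : R) (u : R * R -> R) : \bar R :=
  (\sum_(a < k.+1) \sum_(b < k.+1 | (a + b <= k)%N)
     Lp_norm_disc p r (weak_partial a b u))%E.

End sobolev.

Section mapping_space.
Context {R : realType} {M : Type} {m : nat} (iota : M -> 'rV[R]_m).
Implicit Types f h : sphere R -> M.

Definition local_rep f (i : bool) (j : 'I_m) (z : R * R) : R :=
  iota (f (sphere_chart i z)) ord0 j.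

(* The discs of radius 2 of the two charts cover the sphere, so this is the
   L_k^p-norm of iota o h - iota o f, up to equivalence of norms. *)
Definition sobolev_dist (k : nat) (p : R) h f : \bar R :=
  (\sum_(i : bool) \sum_(j < m)
     sobolev_norm_disc k p 2 (local_rep h i j \- local_rep f i j)%R)%E.

End mapping_space.

Section mapping_space_topological.
Context {R : realType} {M : topologicalType} {m : nat} (iota : M -> 'rV[R]_m).

(* For k - 2/p > 1 every class of L_k^p-maps has a unique continuous
   representative, which is the map meant here. *)
Definition sobolev_maps (k : nat) (p : R) : set (sphere R -> M) :=
  [set f | continuous f /\ forall i j, sobolev_loc k p (local_rep iota f i j)].

Definition nonconst_sobolev_maps (k : nat) (p : R) : set (sphere R -> M) :=
  [set f | sobolev_maps k p f /\ ~ exists y, forall x, f x = y].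

Definition sobolev_ball (k : nat) (p : R) (f : sphere R -> M) (eps : R) :
    set (sphere R -> M) :=
  [set h | sobolev_maps k p h /\ (sobolev_dist iota k p h f < eps%:E)%E].

End mapping_space_topological.

(* Main.v *)
Require Import Defs.
From mathcomp Require Import all_boot all_order all_algebra.
From mathcomp Require Import generic_quotient complex ring lra.
From mathcomp Require Import all_classical all_reals all_analysis.
From mathcomp Require Import measurable_realfun.

(** Smallness in [L_k^p] is used only through uniform smallness.  Since
    [k >= 2], this needs no more than the embedding of [W^{2,1}] of the plane
    into [C^0]: if [rho] is a bump of integral 1 around the coordinate [c] and
    [chi] a fixed bump, then [rho - chi] is the derivative of a function
    bounded by 1 with support in a fixed interval.  Hence a product of two such
    bumps, one for each coordinate, is a sum of the derivatives of orders (1,1),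
    (1,0), (0,1), (0,0) of test functions bounded independently of the width of
    the bumps.  This product approximates a Dirac mass, and pairing it with [u]
    bounds [u] pointwise by the [L^1] norms of its weak derivatives of these
    orders.

    If [h] and [h o g] are both uniformly close to [f], then [f o g] is
    uniformly close to [f].  Suppose this happens for matrices [g] of
    unbounded norm.  The matrices [g / |g|] accumulate at a matrix [b] of norm
    1 and determinant 0, which maps every point of CP^1 outside its kernel to
    the same point; so [f] would be close to a constant outside one point,
    hence everywhere. *)

Set Implicit Arguments.
Unset Strict Implicit.
Unset Printing Implicit Defensive.

Import Order.TTheory GRing.Theory Num.Theory.
Import numFieldNormedType.Exports.

Local Open Scope classical_set_scope.
Local Open Scope ring_scope.

(** * Smooth functions and bumps *)

Section smooth_functions.
Context {R : realType} {V : normedModType R}.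
Implicit Types (f g : V -> R) (S : set (V -> R)).

Lemma smooth_continuous f : smooth_on setT f -> continuous f.
Proof. by move=> sf x; have [] := sf [::] x I. Qed.

Lemma smooth_derivable f x v (sf : smooth_on setT f) : derivable f x v.
Proof. by have [+ _] := sf [::] x I; exact. Qed.

Lemma smooth_derive f v : smooth_on setT f -> smooth_on setT ('D_v f).
Proof.
move=> sf vs x _; have := sf (rcons vs v) x I.
by rewrite /iter_derive foldr_rcons.
Qed.

(** The constructor is binary because the Leibniz rule produces combinations of two terms. *)
Inductive lin_span S : set (V -> R) :=
| span_in f : S f -> lin_span S f
| span_lin a b f g : lin_span S f -> lin_span S g -> lin_span S (fun x => a * f x + b * g x).

Lemma derive_lin a b f g x v : derivable f x v -> derivable g x v ->
  is_derive x v (fun x => a * f x + b * g x) (a * 'D_v f x + b * 'D_v g x).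
Proof.
move=> /derivableP df /derivableP dg.
have -> : (fun x => a * f x + b * g x) = a *: f + b *: g by apply/funext.
exact: is_deriveD.
Qed.

(** If the derivatives of the members of [S] fall back into its span, then so do those of the whole
    span. An induction on the number of derivatives thus never leaves the span, whose elements are
    continuous and derivable. *)
Lemma smooth_span S :
  (forall f, S f -> [/\ continuous f, forall x v, derivable f x v &
                     forall v, lin_span S ('D_v f)]) ->
  forall f, lin_span S f -> smooth_on setT f.
Proof.
move=> hS; have spanS f : lin_span S f -> [/\ continuous f, forall x v, derivable f x v &
                     forall v, lin_span S ('D_v f)].
  elim=> {f} [f /hS//|a b f g _ [cf df Df] _ [cg dg Dg]].
  have D x v := derive_lin a b (df x v) (dg x v).
  split.
  - by move=> x; apply: cvgD; apply: cvgM; try exact: cvg_cst; [exact: cf|exact: cg].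
  - by move=> x v; have [] := D x v.
  - move=> v; rewrite (_ : 'D_v _ = fun x => a * 'D_v f x + b * 'D_v g x).
      exact: span_lin.
    by apply/funext => x; have [] := D x v.
have spanI f vs : lin_span S f -> lin_span S (iter_derive vs f).
  elim: vs => [//|v vs IH] sf /=.
  by have [_ _ /(_ v)] := spanS _ (IH sf).
by move=> f sf vs x _; have [cf df _] := spanS _ (spanI f vs sf); split => //; exact: cf.
Qed.

Lemma smooth_lin a b f g : smooth_on setT f -> smooth_on setT g ->
  smooth_on setT (fun x => a * f x + b * g x).
Proof.
move=> sf sg; apply: (@smooth_span (smooth_on setT)); last by apply: span_lin; exact: span_in.
move=> h sh; split; [exact: smooth_continuous|move=> *; exact: smooth_derivable|].
by move=> v; apply: span_in; exact: smooth_derive.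
Qed.

Lemma smooth_cst c : smooth_on setT (cst c : V -> R).
Proof.
apply: (@smooth_span [set g | exists c, g = cst c]); last by apply: span_in; exists c.
move=> _ [d ->]; split => //; first exact: cst_continuous.
by move=> v; apply: span_in; exists 0; apply/funext => x; rewrite derive_cst.
Qed.

Lemma smoothM f g : smooth_on setT f -> smooth_on setT g ->
  smooth_on setT (fun x => f x * g x).
Proof.
(* The class of all products of two smooth functions: by Leibniz, a derivative is a sum of two such
   products. *)
move=> sf sg; apply: (@smooth_span [set h | exists f g,
  [/\ smooth_on setT f, smooth_on setT g & h = f * g]]); last first.
  by apply: span_in; exists f, g.
move=> _ [{sf sg}f [{}g [sf sg ->]]]; split.
- by move=> x; apply: cvgM; exact: smooth_continuous.
- by move=> x v; apply: derivableM; exact: smooth_derivable.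
- move=> v; rewrite (_ : 'D_v _ =
    fun x => 1 * (f * 'D_v g) x + 1 * (g * 'D_v f) x).
    apply: span_lin; apply: span_in.
      by exists f, ('D_v g); split => //; exact: smooth_derive.
    by exists g, ('D_v f); split => //; exact: smooth_derive.
  by apply/funext => x; rewrite !mul1r deriveM//; exact: smooth_derivable.
Qed.

Lemma derive_smoothM f g x v : smooth_on setT f -> smooth_on setT g ->
  'D_v (fun x => f x * g x) x = f x * 'D_v g x + g x * 'D_v f x.
Proof. by move=> sf sg; apply: deriveM; exact: smooth_derivable. Qed.

Lemma is_derive_inv f x v : f x != 0 -> derivable f x v ->
  is_derive x v (fun x => (f x)^-1) (- (f x) ^- 2 * 'D_v f x).
Proof.
move=> f0 df; split; first exact: derivableV.
by rewrite deriveV.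
Qed.

Lemma is_derive_expr f x v df n : is_derive x v f df ->
  is_derive x v (fun x => f x ^+ n) (n%:R * f x ^+ n.-1 * df).
Proof.
move=> dg; case: n => [|n].
  rewrite mul0r mul0r (_ : (fun x => _) = cst 1); last by apply/funext => y; rewrite expr0.
  exact: is_derive_cst.
rewrite (_ : (fun x => _) = f ^+ n.+1).
  exact: is_deriveX.
by apply/funext => y; rewrite exprfctE.
Qed.

Lemma smoothV g : smooth_on setT g -> (forall x, g x != 0) ->
  smooth_on setT (fun x => (g x)^-1).
Proof.
(* The exponent [n] has to vary, since differentiating raises it by one. *)
move=> sg g0; apply: (@smooth_span [set h | exists n f,
  smooth_on setT f /\ h = (fun x => f x * (g x)^-1 ^+ n)]); last first.
  apply: span_in; exists 1%N, (cst 1); split; first exact: smooth_cst.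
  by apply/funext => x; rewrite mul1r.
move=> _ [n [f [sf ->]]].
have dV x v : is_derive x v (fun x => (g x)^-1 ^+ n)
    (n%:R * (g x)^-1 ^+ n.-1 * (- (g x) ^- 2 * 'D_v g x)).
  have dg := is_derive_inv (g0 x) (@smooth_derivable g x v sg).
  exact: is_derive_expr.
split.
- move=> x; apply: cvgM; first exact: smooth_continuous.
  apply: (@continuous_comp _ _ _ (fun x => (g x)^-1) (fun y : R => y ^+ n));
    last exact: exprn_continuous.
  by apply: cvgV => //; exact: smooth_continuous.
- by move=> x v; apply: derivableM; [exact: smooth_derivable|have [] := dV x v].
- move=> v; rewrite (_ : 'D_v _ = fun x => 1 * ('D_v f x * (g x)^-1 ^+ n) +
    (- n%:R) * ((f x * 'D_v g x) * (g x)^-1 ^+ n.+1)).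
    apply: span_lin; apply: span_in.
      by exists n, ('D_v f); split => //; exact: smooth_derive.
    exists n.+1, (fun x => f x * 'D_v g x); split => //.
    by apply: smoothM => //; exact: smooth_derive.
  apply/funext => x; rewrite deriveM; [|exact: smooth_derivable|by have [] := dV x v].
  have [_ ->] := dV x v; rewrite /GRing.scale /=.
  (* For [n = 0] the exponent [n.-1] is truncated, but the factor [n%:R] kills that term. *)
  case: n {dV} => [|n]; first by rewrite !expr0 mul0r mul0r mulr0 oppr0 mul0r; ring.
  by rewrite -exprVn /= !exprS expr0; ring.
Qed.

End smooth_functions.

Section affine.
Context {R : realType} {V W : normedModType R}.
Variables (l : W -> V) (L : W -> V) (f : V -> R).
Hypothesis lL : forall (h : R) v x, l (h *: v + x) = h *: L v + l x.

(** The difference quotients coincide for every increment, so derivability and the value of the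
    derivative transfer without a chain rule. *)
Let growth x v : (fun h : R => h^-1 *: ((f \o l) (h *: v + x) - (f \o l) x)) =
  (fun h => h^-1 *: (f (h *: L v + l x) - f (l x))).
Proof. by apply/funext => h /=; rewrite lL. Qed.

Lemma derive_affine x v : 'D_v (f \o l) x = 'D_(L v) f (l x).
Proof. by rewrite /derive growth. Qed.

Lemma derivable_affine x v : derivable f (l x) (L v) -> derivable (f \o l) x v.
Proof. by rewrite /derivable growth. Qed.

End affine.

Lemma smooth_affine {R : realType} {V W : normedModType R}
  (l L : W -> V) (f : V -> R) : continuous l ->
  (forall (h : R) v x, l (h *: v + x) = h *: L v + l x) ->
  smooth_on setT f -> smooth_on setT (f \o l).
Proof.
move=> cl lL sf; apply: (@smooth_span _ _ [set h | exists f, smooth_on setT f /\ h = f \o l]);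
  last by apply: span_in; exists f.
move=> _ [g [sg ->]]; split.
- by move=> x; apply: continuous_comp; [exact: cl|exact: smooth_continuous].
- by move=> x v; apply: (derivable_affine lL); exact: smooth_derivable.
- move=> v; apply: span_in; exists ('D_(L v) g); split; first exact: smooth_derive.
  by apply/funext => x; rewrite (derive_affine _ lL).
Qed.

(** * Flat functions, smooth steps and mollifiers on the line *)

Section bump.
Context {R : realType}.
Implicit Types (x y v : R) (n : nat).

(* The functions [x^-n exp(-1/x)] span a space stable under derivation. *)
Definition expV n x : R := if 0 < x then x^-1 ^+ n * expR (- x^-1) else 0.

Lemma expV_ge0 n x : 0 <= expV n x.
Proof.
rewrite /expV; case: ifPn => // x0.
by rewrite mulr_ge0 ?expR_ge0// exprn_ge0// invr_ge0 ltW.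
Qed.

(** The exponential of [x^-1] dominates its power of order [n + 2]; this absorbs [x^-n] and leaves a
    factor [x ^+ 2], enough for a zero derivative at the origin. *)
Lemma expV_le n x : 0 < x -> expV n x <= n.+2%:R ^+ n.+2 * x ^+ 2.
Proof.
move=> x0; rewrite /expV x0.
have y0 : 0 < x^-1 by rewrite invr_gt0.
(* From [1 + t <= expR t] at [t = x^-1 / (n + 2)], raised to the power [n + 2]. *)
have h : (x^-1 / n.+2%:R) ^+ n.+2 <= expR (x^-1).
  rewrite -[X in expR X](@divfK _ n.+2%:R) ?pnatr_eq0// expRM_natr.
  rewrite lerXn2r ?nnegrE ?expR_ge0 ?divr_ge0 ?ltW//.
  by rewrite (lt_le_trans _ (expR_ge1Dx _))// ltrDr.
rewrite expRN ler_pdivrMr ?expR_gt0//.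
apply: le_trans (ler_wpM2l _ h); last by rewrite mulr_ge0 ?exprn_ge0// ltW.
have -> : (x^-1 / n.+2%:R) ^+ n.+2 = x^-1 ^+ n * x^-1 ^+ 2 / n.+2%:R ^+ n.+2.
  by rewrite expr_div_n -exprD addn2.
set a := n.+2%:R ^+ n.+2; set y := x^-1 ^+ n.
have a0 : a != 0 by rewrite expf_neq0 ?pnatr_eq0.
have -> : a * x ^+ 2 * (y * x^-1 ^+ 2 / a) = y * ((x ^+ 2 * x^-1 ^+ 2) * (a / a)) by ring.
by rewrite divff// -exprMn divff ?gt_eqF// expr1n !mulr1.
Qed.

Lemma is_derive_dir (f : R -> R) x d v : is_derive x 1 f d -> is_derive x v f (v * d).
Proof.
move=> [/derivable1_diffP df <-]; split; first exact: diff_derivable.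
by rewrite !deriveE// -[in LHS](mulr1 v) -[v * 1]/(v *: 1) linearZ.
Qed.

Lemma is_derive_expV1 n x :
  is_derive x 1 (expV n) (- n%:R * expV n.+1 x + expV n.+2 x).
Proof.
have [x0|x0|->] := ltgtP x 0.
- rewrite /expV ltNge (ltW x0) /= mulr0 addr0.
  apply: (@near_eq_is_derive R R R (cst (0 : R))).
  near=> y; rewrite ltNge (_ : y <= 0)//.
  by near: y; apply: (@cvgr_le _ _ _ _ id x) => //; exact: cvg_id.
- apply: (@near_eq_is_derive _ _ _ (fun y => y^-1 ^+ n * expR (- y^-1))).
    near=> y; rewrite /expV (_ : 0 < y)//.
    by near: y; apply: (@cvgr_gt _ _ _ _ id x) => //; exact: cvg_id.
  have dV : is_derive x 1 (fun y : R => y^-1) (- x ^- 2 * 1).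
    have := @is_derive_inv _ _ (@id R) x 1; rewrite derive_id; apply.
      by rewrite gt_eqF.
    exact: derivable_id.
  have dX := is_derive_expr n dV.
  have dE : is_derive x 1 (expR \o (fun y : R => - y^-1)) (expR (- x^-1) * - (- x ^- 2 * 1)).
    have dN : is_derive x 1 (fun y : R => - y^-1) (- (- x ^- 2 * 1)) by exact: is_deriveN.
    exact: is_derive1_comp.
  have [dM dMv] : is_derive x 1 (fun y => y^-1 ^+ n * expR (- y^-1)) _ := is_deriveM dX dE.
  split=> //; rewrite dMv /expV x0 /GRing.scale /=.
  case: (n) => [|k]; rewrite -exprVn /= ?exprS ?expr0; ring.
- have e0 m : expV m 0 = 0 by rewrite /expV ltxx.
  rewrite !e0 mulr0 addr0.
  (* By [expV_le], the difference quotient at the origin is at most a constant times [|h|]. *)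
  have : (fun h : R => h^-1 *: ((expV n \o shift 0) (h *: 1) - expV n 0)) @ 0^' --> (0 : R).
    apply/cvgr0Pnorm_le => e e_gt0.
    near=> h; rewrite /= e0 subr0 addr0 [h%:A]mulr1 /GRing.scale /= normrM normfV.
    have h0 : h != 0 by near: h; exact: nbhs_dnbhs_neq.
    rewrite ler_pdivrMl ?normr_gt0// ger0_norm ?expV_ge0//.
    have [h_gt0|h_le0] := ltP 0 h; last first.
      by rewrite /expV ltNge h_le0 /= mulr_ge0// ltW.
    apply: le_trans (expV_le n h_gt0) _; rewrite expr2 gtr0_norm// mulrCA ler_pM2l//.
    rewrite -ler_pdivlMl ?exprn_gt0//.
    have : `|h| <= (n.+2%:R ^+ n.+2)^-1 * e.
      near: h; apply: dnbhs0_le.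
      by rewrite mulr_gt0// invr_gt0 exprn_gt0.
    by rewrite gtr0_norm.
  by move=> h; split; [apply/cvg_ex; exists 0|exact: cvg_lim].
Unshelve. all: by end_near. Qed.

Lemma is_derive_expV n x v :
  is_derive x v (expV n) (v * (- n%:R * expV n.+1 x + expV n.+2 x)).
Proof. exact/is_derive_dir/is_derive_expV1. Qed.

Lemma smooth_expV n : smooth_on setT (expV n).
Proof.
apply: (@smooth_span _ _ (range expV)); last by apply: span_in; exists n.
move=> _ [m _ <-]; split.
- move=> x; apply: differentiable_continuous; apply/derivable1_diffP.
  by have [] := is_derive_expV m x 1.
- by move=> x v; have [] := is_derive_expV m x v.
- move=> v; rewrite (_ : 'D_v _ = fun x => (v * - m%:R) * expV m.+1 x + v * expV m.+2 x).
    by apply: span_lin; apply: span_in; [exists m.+1|exists m.+2].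
  by apply/funext => x; have [_ ->] := is_derive_expV m x v; ring.
Qed.


(** One of [1 + x] and [1 - x] is always positive, so this sum never vanishes. *)
Definition step_den x : R := expV 0 (1 + x) + expV 0 (1 - x).

Lemma step_den_gt0 x : 0 < step_den x.
Proof.
have pos y : 0 < y -> 0 < expV 0 y by move=> y0; rewrite /expV y0 expr0 mul1r expR_gt0.
have [x0|x0] := leP x 0.
  by rewrite /step_den ltr_wpDl ?expV_ge0 ?pos//; lra.
by rewrite /step_den ltr_pwDl ?expV_ge0 ?pos//; lra.
Qed.

(** The classical smooth transition function, constant on either side of [-1, 1]. *)
Definition step x : R := expV 0 (1 + x) / step_den x.

Lemma step_ge0 x : 0 <= step x.
Proof. by rewrite /step divr_ge0 ?expV_ge0// ltW// step_den_gt0. Qed.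

Lemma step_le1 x : step x <= 1.
Proof. by rewrite /step ler_pdivrMr ?step_den_gt0// mul1r /step_den lerDl expV_ge0. Qed.

Lemma step_le x : x <= -1 -> step x = 0.
Proof. by move=> x1; rewrite /step /expV ltNge (_ : 1 + x <= 0) ?mul0r//; lra. Qed.

Lemma step_ge x : 1 <= x -> step x = 1.
Proof.
move=> x1; rewrite /step -[X in _ / X](_ : expV 0 (1 + x) = _).
  by rewrite divff// -[_ (1 + x)](_ : step_den x = _) ?gt_eqF ?step_den_gt0//
    /step_den {2}/expV ltNge (_ : 1 - x <= 0) ?addr0//; lra.
by rewrite /step_den {3}/expV ltNge (_ : 1 - x <= 0) ?addr0//; lra.
Qed.

Let smooth_num : smooth_on setT (fun x => expV 0 (1 + x)).
Proof.
apply: (@smooth_affine _ _ _ (fun x => 1 + x) id); last exact: smooth_expV.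
- by move=> x; apply: cvgD; [exact: cvg_cst|exact: cvg_id].
- by move=> h v x; rewrite addrCA.
Qed.

Let smooth_den2 : smooth_on setT (fun x => expV 0 (1 - x)).
Proof.
apply: (@smooth_affine _ _ _ (fun x => 1 - x) -%R); last exact: smooth_expV.
- by move=> x; apply: cvgB; [exact: cvg_cst|exact: cvg_id].
- by move=> h v x; rewrite opprD addrCA scalerN.
Qed.

Lemma smooth_step : smooth_on setT step.
Proof.
apply: smoothM => //; apply: smoothV => [|x]; last by rewrite gt_eqF ?step_den_gt0.
have := smooth_lin 1 1 smooth_num smooth_den2.
by under eq_fun do rewrite !mul1r.
Qed.

(** After the quotient rule the terms that would spoil the sign cancel. Each remaining product is
    nonnegative and has a factor in [1 + x] and one in [1 - x], which yields both the sign and the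
    support of the mollifier. *)
Lemma derive_step x : 'D_1 step x =
  (expV 2 (1 + x) * expV 0 (1 - x) + expV 0 (1 + x) * expV 2 (1 - x)) / step_den x ^+ 2.
Proof.
have d1 : is_derive x 1 (fun x => expV 0 (1 + x)) (expV 2 (1 + x)).
  split; first exact: smooth_derivable.
  rewrite (@derive_affine _ _ _ (fun x => 1 + x) id); last by move=> h v y; rewrite addrCA.
  by have [_ ->] := is_derive_expV1 0 (1 + x); rewrite oppr0 mul0r add0r.
have d2 : is_derive x 1 (fun x => expV 0 (1 - x)) (- expV 2 (1 - x)).
  split; first exact: smooth_derivable.
  rewrite (@derive_affine _ _ _ (fun x => 1 - x) -%R);
    last by move=> h v y; rewrite opprD addrCA scalerN.
  by have [_ ->] := is_derive_expV 0 (1 - x) (-1); rewrite oppr0 mul0r add0r mulN1r.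
have d3 : is_derive x 1 step_den (expV 2 (1 + x) + - expV 2 (1 - x)) by exact: is_deriveD.
have n0 : step_den x != 0 by rewrite gt_eqF ?step_den_gt0.
have d4 : is_derive x 1 (fun x => (step_den x)^-1)
   (- (step_den x) ^- 2 * (expV 2 (1 + x) + - expV 2 (1 - x))).
  by have [dd <-] := d3; exact: is_derive_inv.
have [_ ->] : is_derive x 1 step (expV 0 (1 + x) *
  (- (step_den x) ^- 2 * (expV 2 (1 + x) + - expV 2 (1 - x))) +
  (step_den x)^-1 * expV 2 (1 + x)) by exact: is_deriveM.
have -> : (step_den x)^-1 = step_den x / step_den x ^+ 2.
  by rewrite expr2 invfM mulrA mulfV// mul1r.
rewrite {2}/step_den; ring.
Qed.

Lemma derive_step_ge0 x : 0 <= 'D_1 step x.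
Proof.
by rewrite derive_step divr_ge0 ?sqr_ge0 ?addr_ge0 ?mulr_ge0 ?expV_ge0.
Qed.

Lemma derive_step_out x : 1 <= `|x| -> 'D_1 step x = 0.
Proof.
rewrite ler_normr derive_step => /orP[x1|x1].
  by rewrite {2 4}/expV ltNge (_ : 1 - x <= 0) ?mulr0 ?addr0 ?mul0r//; lra.
by rewrite {1 3}/expV ltNge (_ : 1 + x <= 0) ?mul0r ?addr0 ?mul0r//; lra.
Qed.

Variables (d c : R).
Hypothesis d0 : 0 < d.

Definition ramp x : R := step (d^-1 * x - d^-1 * c).

(** Obtained as the derivative of [ramp], so that its mass 1 is the total rise of [ramp]. *)
Definition mollifier x : R := d^-1 * 'D_1 step (d^-1 * x - d^-1 * c).

Lemma smooth_ramp : smooth_on setT ramp.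
Proof.
apply: (@smooth_affine _ _ _ (fun x => d^-1 * x - d^-1 * c) (fun v => d^-1 * v));
  last exact: smooth_step.
- by move=> x; apply: cvgB; [apply: cvgM; [exact: cvg_cst|exact: cvg_id]|exact: cvg_cst].
- by move=> h v x; rewrite /GRing.scale /=; ring.
Qed.

Lemma is_derive_ramp x : is_derive x 1 ramp (mollifier x).
Proof.
split; first exact: smooth_derivable smooth_ramp.
rewrite (@derive_affine _ _ _ (fun x => d^-1 * x - d^-1 * c) (fun v => d^-1 * v)).
  rewrite mulr1 /mollifier.
  have : is_derive (d^-1 * x - d^-1 * c) 1 step ('D_1 step (d^-1 * x - d^-1 * c)).
    by apply: derivableP; exact: smooth_derivable smooth_step.
  by move/(is_derive_dir d^-1) => [_ ->].
by move=> h v y; rewrite /GRing.scale /=; ring.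
Qed.

Lemma smooth_mollifier : smooth_on setT mollifier.
Proof.
rewrite (_ : mollifier = 'D_1 ramp); first exact: smooth_derive smooth_ramp.
by apply/funext => x; have [_ ->] := is_derive_ramp x.
Qed.

Lemma mollifier_ge0 x : 0 <= mollifier x.
Proof. by rewrite /mollifier mulr_ge0 ?derive_step_ge0 ?invr_ge0 ?ltW. Qed.

Lemma mollifier_out x : d <= `|x - c| -> mollifier x = 0.
Proof.
move=> xc; rewrite /mollifier derive_step_out ?mulr0//.
by rewrite -mulrBr normrM gtr0_norm ?invr_gt0// ler_pdivlMl ?mulr1.
Qed.

Lemma ramp_le x : x <= c - d -> ramp x = 0.
Proof.
by move=> xc; rewrite /ramp step_le// -mulrBr ler_pdivrMl// mulrN1; lra.
Qed.

Lemma ramp_ge x : c + d <= x -> ramp x = 1.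
Proof.
by move=> xc; rewrite /ramp step_ge// -mulrBr ler_pdivlMl// mulr1; lra.
Qed.

Lemma ramp_ge0 x : 0 <= ramp x. Proof. exact: step_ge0. Qed.

Lemma ramp_le1 x : ramp x <= 1. Proof. exact: step_le1. Qed.

End bump.

(** * Integration in the plane *)

Section plane.
Context {R : realType}.
Implicit Types (u v g psi : R * R -> R) (r : R).
Local Notation mu := (@lebesgue2 R).

(** Measurability refers to the product sigma-algebra; an open set is the countable union of the
    boxes with rational centre and size that it contains. *)
Lemma open_measurable2 (U : set (R * R)) : open U -> measurable U.
Proof.
move=> oU.
pose box (q1 q2 e : rat) : set (R * R) :=
  ball (ratr q1 : R) (ratr e) `*` ball (ratr q2 : R) (ratr e).
rewrite (_ : U = \bigcup_q1 \bigcup_q2 \bigcup_e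
    (if pselect (box q1 q2 e `<=` U) then box q1 q2 e else set0)).
  apply: bigcupT_measurable_rat => q1; apply: bigcupT_measurable_rat => q2.
  apply: bigcupT_measurable_rat => e; case: pselect => [?|?] //=.
  by apply: measurableX; exact: measurable_ball.
apply/seteqP; split => [z Uz|z [q1 _ [q2 _ [e _]]]]; last first.
  by case: pselect => [bU|?] //= /bU.
have /nbhs_ballP[e /= e0 eU] : nbhs z U by exact: open_nbhs_nbhs.
(* The box has centre within [q] of [z] and half-side [q], so its points are within [2 q < e] of
   [z]. *)
have /rat_in_itvoo[q /[!in_itv]/= /andP[q0 qe]] : 0 < e / 2 by rewrite divr_gt0.
have /rat_in_itvoo[q1 /[!in_itv]/= /andP[q1l q1r]] : z.1 - ratr q < z.1 + ratr q by lra.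
have /rat_in_itvoo[q2 /[!in_itv]/= /andP[q2l q2r]] : z.2 - ratr q < z.2 + ratr q by lra.
exists q1 => //; exists q2 => //; exists q => //; case: pselect => [?|nU] /=.
  by split; rewrite -ball_normE /ball_/= ltr_norml; apply/andP; split; lra.
exfalso; apply: nU => w [w1 w2]; apply: eU.
move: w1 w2; rewrite -!ball_normE /ball_/= !ltr_norml => /andP[a1 a2] /andP[b1 b2].
by rewrite prod_normE gt_max /= !ltr_norml; apply/andP; split; apply/andP; split; lra.
Qed.

Lemma continuous_measurable2 u : continuous u -> measurable_fun setT u.
Proof.
move=> /continuousP cu; apply: (measurability _ (RGenOpens.measurableE R)).
move=> _ [_ [a [b ->] <-]]; rewrite setTI; apply: open_measurable2.
exact/cu/interval_open.
Qed.

Lemma disc_sub_box r : disc r `<=` `[- `|r|, `|r|] `*` `[- `|r|, `|r|].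
Proof.
move=> z; rewrite /disc/= => zr; rewrite !in_itv/= -!ler_norml.
rewrite -(ler_sqr (normr_ge0 _))// -(ler_sqr (normr_ge0 z.2))// !real_normK ?num_real//.
by have := sqr_ge0 z.1; have := sqr_ge0 z.2; split; lra.
Qed.

Lemma measurable_disc r : measurable (@disc R r).
Proof.
apply: open_measurable2.
rewrite (_ : disc r = (fun z : R * R => z.1 ^+ 2 + z.2 ^+ 2) @^-1` [set x | x < r ^+ 2])//.
apply: open_comp => [z _|]; last exact: open_lt.
apply: cvgD; rewrite !expr2; apply: cvgM; first [exact: cvg_fst|exact: cvg_snd].
Qed.

Lemma lebesgue2_disc r : (mu (disc r) < +oo)%E.
Proof.
pose box : set (R * R) := `[- `|r|, `|r|] `*` `[- `|r|, `|r|].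
have le : (mu (disc r) <= mu box)%E.
  apply: le_measure; rewrite ?inE; [exact: measurable_disc| |exact: disc_sub_box].
  by apply: measurableX.
apply: (le_lt_trans le).
rewrite /lebesgue2 product_measure1E//= !lebesgue_measure_itv /=.
by case: ifPn => _; rewrite ?mul0e// -EFinB -EFinM ltry.
Qed.

Lemma bounded_continuous_support g r : continuous g ->
  (forall z, ~ disc r z -> g z = 0) -> exists B : R, forall z, `|g z| <= B.
Proof.
move=> cg g0.
have : compact (g @` (`[- `|r|, `|r|] `*` `[- `|r|, `|r|])).
  apply: continuous_compact; first exact: continuous_subspaceT.
  by apply: compact_setX; exact: segment_compact.
move=> /compact_bounded[M [Mr hM]]; exists (1 + `|M|) => z.
have [dz|/g0 ->] := pselect (disc r z); last by rewrite normr0 addr_ge0.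
apply: hM; first by rewrite (le_lt_trans (ler_norm _))// ltrDr.
by exists z => //; exact: disc_sub_box.
Qed.

Lemma integrable_continuous_support g r : continuous g ->
  (forall z, ~ disc r z -> g z = 0) -> mu.-integrable setT (EFin \o g).
Proof.
move=> cg g0.
have -> : EFin \o g = (EFin \o g) \_ (disc r).
  apply/funext => z; rewrite patchE; case: ifPn => //.
  by move/negP => nz; rewrite /= g0// => dz; apply: nz; rewrite inE.
rewrite -integrable_mkcond; last exact: measurable_disc.
apply: measurable_bounded_integrable.
- exact: measurable_disc.
- exact: lebesgue2_disc.
- by apply: measurable_funTS; exact: continuous_measurable2.
- have [B gB] := bounded_continuous_support cg g0.
  exists B; split => [|M BM z _]; first exact: num_real.
  by apply: (le_trans (gB z)); exact: ltW.
Qed.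

Lemma Lp_norm_disc1 v r : Lp_norm_disc 1 r v = (\int[mu]_z `|v \_ (disc r) z|%:E)%E.
Proof. by rewrite /Lp_norm_disc Lnorm1. Qed.

Lemma measurable_restrict_disc v r :
  measurable_fun setT v -> measurable_fun setT (v \_ (disc r)).
Proof.
move=> mv; apply/(measurable_restrictT _ _).1; first exact: measurable_disc.
exact: measurable_funTS.
Qed.

Lemma Lp_loc1_integrable v r : Lp_loc 1 v ->
  mu.-integrable setT (EFin \o v \_ (disc r)).
Proof.
move=> [mv vfin]; apply/integrableP; split.
  by apply/measurable_EFinP; exact: measurable_restrict_disc.
by have := vfin r; rewrite Lp_norm_disc1.
Qed.

(** The duality of L^1 and L^infinity; the support of [psi] allows [v] to be replaced by its
    restriction to the disc, which is integrable. *)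
Lemma integrable_weak v psi (B r : R) : Lp_loc 1 v -> measurable_fun setT psi ->
  (forall z, `|psi z| <= B) -> (forall z, ~ disc r z -> psi z = 0) ->
  mu.-integrable setT (EFin \o (fun z => v z * psi z)) /\
  (`|\int[mu]_z (v z * psi z)|%:E <= B%:E * Lp_norm_disc 1 r v)%E.
Proof.
move=> lv mpsi psiB psi0; have [mv _] := lv.
have B0 : 0 <= B by apply: le_trans (psiB (0, 0)).
have mvd := measurable_restrict_disc r mv.
have vE z : v z * psi z = v \_ (disc r) z * psi z.
  rewrite patchE; case: ifPn => // /negP nz; rewrite psi0 ?mulr0// => dz.
  by apply: nz; rewrite inE.
have iv := Lp_loc1_integrable r lv.
have iB : mu.-integrable setT (fun z => (B%:E * (EFin \o v \_ (disc r)) z)%E).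
  exact: integrableZl.
have mvpsi : measurable_fun setT (fun z => v z * psi z) by exact: measurable_funM.
have le z : (`|(v z * psi z)%:E| <= `|B%:E * (v \_ (disc r) z)%:E|)%E.
  rewrite -EFinM !abse_EFin lee_fin vE !normrM mulrC (ger0_norm B0).
  by rewrite ler_wpM2r.
have ivp : mu.-integrable setT (EFin \o (fun z => v z * psi z)).
  apply: (le_integrable measurableT _ _ iB); [exact/measurable_EFinP|by move=> z _; exact: le].
split => //.
rewrite EFin_normr_Rintegral//; apply: le_trans (le_abse_integral _ _ _) _ => //.
  exact/measurable_EFinP.
rewrite Lp_norm_disc1 -ge0_integralZl//; last first.
  by apply/measurable_EFinP; exact: measurableT_comp.
apply: ge0_le_integral => //.
- by apply: measurableT_comp => //; exact/measurable_EFinP.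
- apply: measurable_funeM; apply/measurable_EFinP; exact: measurableT_comp.
- move=> z _; apply: le_trans (le z) _.
  by rewrite -EFinM abse_EFin normrM (ger0_norm B0).
Qed.

(** Hoelder's inequality against the indicator of the disc, whose norm for the conjugate exponent is
    the constant. The case [p = 1] is apart because that exponent is then infinite. *)
Lemma Lp_norm_disc_le p : 1 <= p -> exists2 C : R, 0 <= C &
  forall v, measurable_fun setT v ->
    (Lp_norm_disc 1 2 v <= C%:E * Lp_norm_disc p 2 v)%E.
Proof.
rewrite le_eqVlt => /predU1P[<-|p1].
  by exists 1 => // v _; rewrite mul1e.
pose q := (1 - p^-1)^-1.
have p0 : 0 < p by lra.
have pV1 : p^-1 < 1 by rewrite invf_lt1.
have q0 : 0 < q by rewrite invr_gt0 subr_gt0.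
pose I : R * R -> R := \1_(disc 2).
have NI : ('N[mu]_q%:E[EFin \o I] < +oo)%E.
  rewrite unlock /Lnorm poweR_lty//.
  rewrite (_ : (fun x => _) = EFin \o I).
    rewrite integral_indic ?setIT//; first exact: lebesgue2_disc.
    exact: measurable_disc.
  apply/funext => z; rewrite /I /= indicE; case: (z \in _) => /=.
    by rewrite normr1 powR1.
  by rewrite normr0 powR0// gt_eqF.
exists (fine ('N[mu]_q%:E[EFin \o I])); first by rewrite fine_ge0// Lnorm_ge0.
move=> v mv; have mvd := measurable_restrict_disc 2 mv.
rewrite fineK; last by rewrite ge0_fin_numE// Lnorm_ge0.
have mI : measurable_fun setT I.
  by apply: measurable_indic; exact: measurable_disc.
have := @hoelder _ _ _ mu (v \_ (disc 2)) I p q mvd mI p0 q0.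
rewrite /q invrK addrC subrK => /(_ erefl).
rewrite muleC /Lp_norm_disc; congr (_ <= _)%E; congr Lnorm.
apply/funext => z; rewrite /= /I indicE patchE; case: ifPn => _; rewrite ?mulr1 ?mul0r//.
Qed.

End plane.

(** * Products of one-variable bumps and pointwise evaluation *)

Section tensor.
Context {R : realType}.
Implicit Types (F G : R -> R) (u v : R * R -> R).
Local Notation mu := (@lebesgue2 R).

Definition tensor F G (z : R * R) : R := F z.1 * G z.2.

Let smooth_fst F : smooth_on setT F -> smooth_on setT (F \o (@fst R R)).
Proof. by apply: (@smooth_affine _ _ _ fst fst) => // z; exact: cvg_fst. Qed.

Let smooth_snd F : smooth_on setT F -> smooth_on setT (F \o (@snd R R)).
Proof. by apply: (@smooth_affine _ _ _ snd snd) => // z; exact: cvg_snd. Qed.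

Lemma smooth_tensor F G : smooth_on setT F -> smooth_on setT G ->
  smooth_on setT (tensor F G).
Proof. by move=> sF sG; apply: smoothM; [exact: smooth_fst|exact: smooth_snd]. Qed.

Lemma derive_tensor1 F G : smooth_on setT F -> smooth_on setT G ->
  'D_(1, 0) (tensor F G) = tensor ('D_1 F) G.
Proof.
move=> sF sG; apply/funext => z.
rewrite (derive_smoothM z (1, 0) (smooth_fst sF) (smooth_snd sG)).
rewrite (@derive_affine _ _ _ snd snd)// (@derive_affine _ _ _ fst fst)//=.
by rewrite derive0 mulr0 add0r mulrC.
Qed.

Lemma derive_tensor2 F G : smooth_on setT F -> smooth_on setT G ->
  'D_(0, 1) (tensor F G) = tensor F ('D_1 G).
Proof.
move=> sF sG; apply/funext => z.
rewrite (derive_smoothM z (0, 1) (smooth_fst sF) (smooth_snd sG)).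
rewrite (@derive_affine _ _ _ snd snd)// (@derive_affine _ _ _ fst fst)//=.
by rewrite derive0 mulr0 addr0.
Qed.

(* The square of half-side 7/5 lies between the unit disc and the disc of
   radius 2, with room for bumps of radius 2/5 around points of the former. *)
Lemma tensor_support F G : (forall x, 7 / 5 <= `|x| -> F x = 0) ->
  (forall x, 7 / 5 <= `|x| -> G x = 0) -> forall z, ~ disc 2 z -> tensor F G z = 0.
Proof.
move=> F0 G0 z; rewrite /tensor.
have [/F0 -> _|z1] := leP (7 / 5) `|z.1|; first by rewrite mul0r.
have [/G0 -> _|z2 []] := leP (7 / 5) `|z.2|; first by rewrite mulr0.
rewrite /disc/= -(real_normK (num_real z.1)) -(real_normK (num_real z.2)).
have := normr_ge0 z.1; have := normr_ge0 z.2; nra.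
Qed.

Lemma test_tensor F G : smooth_on setT F -> smooth_on setT G ->
  (forall x, 7 / 5 <= `|x| -> F x = 0) -> (forall x, 7 / 5 <= `|x| -> G x = 0) ->
  test_function (tensor F G).
Proof.
by move=> sF sG F0 G0; split; [exact: smooth_tensor|exists 2; exact: tensor_support].
Qed.

(** The fundamental theorem of calculus on [[c - d, c + d]], where [ramp] climbs from 0 to 1. *)
Lemma integral_mollifier d c : 0 < d ->
  (\int[lebesgue_measure]_x (mollifier d c x)%:E = 1 :> \bar R)%E.
Proof.
move=> d0; have cb := smooth_continuous (smooth_mollifier d c).
have -> : (fun x => (mollifier d c x)%:E) = (EFin \o mollifier d c) \_ `[c - d, c + d].
  apply/funext => x; rewrite patchE; case: ifPn => // xn; rewrite mollifier_out//.
  rewrite leNgt; apply: contra xn; rewrite ltr_norml inE/= in_itv/= => /andP[? ?].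
  by apply/andP; split; lra.
rewrite -integral_mkcond (@continuous_FTC2 _ _ (ramp d c)); last 4 first.
- by lra.
- by apply: continuous_subspaceT.
- have cS := smooth_continuous (smooth_ramp d c).
  split.
  + by move=> x _; exact: smooth_derivable (smooth_ramp d c).
  + by apply: cvg_at_right_filter; exact: cS.
  + by apply: cvg_at_left_filter; exact: cS.
- by move=> x _; rewrite derive1E; have [_ ->] := is_derive_ramp d c x.
by rewrite ramp_ge// ramp_le// sube0.
Qed.

Lemma integral_tensor_bump d a b : 0 < d ->
  (\int[mu]_z (tensor (mollifier d a) (mollifier d b) z)%:E = 1 :> \bar R)%E.
Proof.
move=> d0.
have ct : continuous (tensor (mollifier d a) (mollifier d b)).
  by apply: smooth_continuous; apply: smooth_tensor; exact: smooth_mollifier.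
have -> : (\int[mu]_z (tensor (mollifier d a) (mollifier d b) z)%:E =
    \int[lebesgue_measure \x lebesgue_measure]_z
      ((EFin \o tensor (mollifier d a) (mollifier d b)) z))%E by [].
rewrite fubini_tonelli1; last 2 first.
- by apply/measurable_EFinP; exact: continuous_measurable2.
- by move=> z; rewrite lee_fin mulr_ge0// mollifier_ge0.
transitivity (\int[lebesgue_measure]_x (mollifier d a x)%:E)%E; last exact: integral_mollifier.
apply: eq_integral => x _; rewrite /fubini_F /=.
under eq_integral do rewrite /tensor /= EFinM.
rewrite ge0_integralZl//.
- by rewrite integral_mollifier// mule1.
- apply/measurable_EFinP; apply: continuous_measurable_fun.
  by apply: smooth_continuous; exact: smooth_mollifier.
- by move=> y _; rewrite lee_fin mollifier_ge0.
- by rewrite lee_fin mollifier_ge0.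
Qed.

(** Far out the two ramps are both 0 or both 1, so this primitive of a difference of mollifiers has
    compact support. The coefficients 1 and -1 fit [smooth_lin] and [derive_lin]. *)
Definition window d c x : R := 1 * ramp d c x + (-1) * ramp 1 0 x.

Section window.
Variables (d c : R).
Hypotheses (d0 : 0 < d) (d1 : d <= 2 / 5) (c1 : `|c| <= 1).

Lemma smooth_window : smooth_on setT (window d c).
Proof. by apply: smooth_lin; apply: smooth_ramp. Qed.

Lemma derive_window : 'D_1 (window d c) = fun x => mollifier d c x - mollifier 1 0 x.
Proof.
apply/funext => x.
have [dS SE] := is_derive_ramp d c x.
have [dT TE] := is_derive_ramp 1 0 x.
by have [_ ->] := derive_lin 1 (-1) dS dT; rewrite SE TE mul1r mulN1r.
Qed.

Lemma window_le1 x : `|window d c x| <= 1.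
Proof.
rewrite /window ler_norml.
have := ramp_ge0 d c x; have := ramp_le1 d c x.
have := ramp_ge0 1 0 x; have := ramp_le1 1 0 x.
by move=> *; apply/andP; split; lra.
Qed.

(** Since [|c| + d <= 7 / 5], both ramps have reached the same constant beyond [7 / 5]. *)
Lemma window_out x : 7 / 5 <= `|x| -> window d c x = 0.
Proof.
rewrite /window ler_normr; move: c1; rewrite ler_norml => /andP[cl cr] /orP[xl|xl].
  by rewrite !ramp_ge//; move: d1 xl cr; lra.
by rewrite !ramp_le//; move: d1 xl cl; lra.
Qed.

Lemma mollifier_support x : 7 / 5 <= `|x| -> mollifier d c x = 0.
Proof.
move=> x7; apply: mollifier_out => //.
have := ler_normB (x - c) (- c); rewrite opprK subrK normrN.
by move: d1 c1 x7; lra.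
Qed.

End window.

(** The bound is taken at least 1 so that it also bounds the windows. *)
Lemma mollifier_bounded : exists2 b : R, 1 <= b & forall x, mollifier 1 0 x <= b.
Proof.
have cb : continuous (mollifier (1 : R) 0) by apply: smooth_continuous; exact: smooth_mollifier.
have : compact (mollifier (1 : R) 0 @` `[-1, 1]).
  by apply: continuous_compact; [exact: continuous_subspaceT|exact: segment_compact].
move=> /compact_bounded[M [Mr hM]]; exists (1 + `|M|); first by rewrite lerDl.
move=> x; have [x1|x1] := leP 1 `|x|.
  by rewrite mollifier_out ?subr0// addr_ge0.
apply: le_trans (ler_norm _) _; apply: hM.
  by rewrite (le_lt_trans (ler_norm _))// ltrDr.
by exists x => //=; rewrite in_itv/= -ler_norml ltW.
Qed.

Lemma mollifier1_support x : 7 / 5 <= `|x| -> mollifier (1 : R) 0 x = 0.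
Proof. by move=> x7; rewrite mollifier_out// subr0; lra. Qed.


Lemma disc_coords (z : R * R) : z.1 ^+ 2 + z.2 ^+ 2 <= 1 -> `|z.1| <= 1 /\ `|z.2| <= 1.
Proof.
rewrite -(real_normK (num_real z.1)) -(real_normK (num_real z.2)).
by have := normr_ge0 z.1; have := normr_ge0 z.2; split; nra.
Qed.

(** The definition of the weak derivative moves the derivatives from the test function to [v]; the
    sign disappears in the absolute value. *)
Lemma weak_bound u v a b F G (B : R) : is_weak_partial a b u v ->
  smooth_on setT F -> smooth_on setT G ->
  (forall x, 7 / 5 <= `|x| -> F x = 0) -> (forall x, 7 / 5 <= `|x| -> G x = 0) ->
  (forall z, `|tensor F G z| <= B) ->
  (`|\int[mu]_z (u z * partial a b (tensor F G) z)|%:E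
    <= B%:E * Lp_norm_disc 1 2 v)%E.
Proof.
move=> wuv sF sG F0 G0 FGB; have [lv ->] := wuv; last exact: test_tensor.
rewrite normrM normrX normrN1 expr1n mul1r.
have mFG : measurable_fun setT (tensor F G).
  by apply: continuous_measurable2; apply: smooth_continuous; exact: smooth_tensor.
by have [_] := integrable_weak lv mFG FGB (tensor_support F0 G0).
Qed.

Lemma near_box (u : R * R -> R) (z0 : R * R) (e : R) : continuous u -> 0 < e ->
  exists2 d : R, 0 < d <= 2 / 5 & forall z, `|z.1 - z0.1| < d -> `|z.2 - z0.2| < d ->
    `|u z - u z0| <= e.
Proof.
move=> cu e0; have /cvgrPdist_le /(_ e e0) /nbhs_ballP[d /= d0 hd] := cu z0.
(* The cap [2 / 5] keeps bumps around points of the unit disc inside the square of half-side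
   [7 / 5]. *)
exists (Num.min d (2 / 5)); first by rewrite lt_min d0 ge_min lexx orbT andbT/=; lra.
move=> z; rewrite !lt_min => /andP[z1 _] /andP[z2 _]; rewrite distrC; apply: hd.
by split; rewrite -ball_normE /ball_/= distrC.
Qed.

(** The product of mollifiers is a probability density concentrated where [u] is within [e] of
    [u z0]. *)
Lemma mean_near (u : R * R -> R) (z0 : R * R) (e d : R) :
  continuous u -> 0 <= e -> 0 < d <= 2 / 5 ->
  z0.1 ^+ 2 + z0.2 ^+ 2 <= 1 ->
  (forall z, `|z.1 - z0.1| < d -> `|z.2 - z0.2| < d -> `|u z - u z0| <= e) ->
  `|u z0 - \int[mu]_z (u z * tensor (mollifier d z0.1) (mollifier d z0.2) z)| <= e.
Proof.
move=> cu e0 /andP[d0 d1] /disc_coords[z1 z2] ue.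
set rho := tensor _ _.
have crho : continuous rho.
  by apply: smooth_continuous; apply: smooth_tensor; exact: smooth_mollifier.
have rho_out : forall z, ~ disc 2 z -> rho z = 0.
  by apply: tensor_support; apply: mollifier_support.
have rho0 z : 0 <= rho z by rewrite mulr_ge0// mollifier_ge0.
have int_rho : \int[mu]_z rho z = 1 by rewrite /Rintegral integral_tensor_bump.
have int (g : R * R -> R) : continuous g ->
    mu.-integrable setT (EFin \o (fun z => g z * rho z)).
  move=> cg; apply: (@integrable_continuous_support _ _ 2).
    by move=> z; apply: cvgM; [exact: cg|exact: crho].
  by move=> z /rho_out ->; rewrite mulr0.
have ic c : mu.-integrable setT (EFin \o (fun z => c * rho z)).
  by apply: (int (fun=> c)); exact: cst_continuous.
have irho : mu.-integrable setT (EFin \o rho).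
  by have := ic 1; under [X in _.-integrable _ X -> _]eq_fun do rewrite /= mul1r.
have -> : u z0 = \int[mu]_z (u z0 * rho z).
  by rewrite RintegralZl// int_rho mulr1.
rewrite -RintegralB//; last exact: int.
have idiff : mu.-integrable setT (EFin \o (fun z => u z0 * rho z - u z * rho z)).
  have := int (fun z => u z0 - u z); under [X in _.-integrable _ X]eq_fun do rewrite /= mulrBl.
  by apply; move=> z; apply: cvgB; [exact: cvg_cst|exact: cu].
apply: le_trans (le_normr_Rintegral _ idiff) _ => //.
have -> : e = \int[mu]_z (e * rho z) by rewrite RintegralZl// int_rho mulr1.
apply: le_Rintegral => //.
  exact: integrable_norm.
move=> z _; rewrite -mulrBl normrM (ger0_norm (rho0 z)).
have [z1d|z1d] := ltP `|z.1 - z0.1| d; last first.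
  by rewrite /rho /tensor mollifier_out// mul0r !mulr0.
have [z2d|z2d] := ltP `|z.2 - z0.2| d; last first.
  by rewrite /rho /tensor (mollifier_out d0 z2d) !mulr0.
by rewrite ler_wpM2r// distrC ue.
Qed.

Lemma ler_norm_add4 (w a1 a2 a3 a4 e : R) : `|w - (a1 + a2 + a3 + a4)| <= e ->
  `|w| <= `|a1| + `|a2| + `|a3| + `|a4| + e.
Proof.
have := ler_normD (w - (a1 + a2 + a3 + a4)) (a1 + a2 + a3 + a4); rewrite subrK.
have := ler_normD (a1 + a2 + a3) a4; have := ler_normD (a1 + a2) a3.
by have := ler_normD a1 a2; lra.
Qed.

Lemma sobolev_eval : exists2 B : R, 0 <= B &
  forall u v00 v10 v01 v11 : R * R -> R, continuous u ->
    is_weak_partial 0 0 u v00 -> is_weak_partial 1 0 u v10 ->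
    is_weak_partial 0 1 u v01 -> is_weak_partial 1 1 u v11 ->
  forall z0 : R * R, z0.1 ^+ 2 + z0.2 ^+ 2 <= 1 ->
  (`|u z0|%:E <= B%:E * Lp_norm_disc 1 2 v11 + B%:E * Lp_norm_disc 1 2 v10 +
    B%:E * Lp_norm_disc 1 2 v01 + B%:E * Lp_norm_disc 1 2 v00)%E.
Proof.
have [b b1 chib] := mollifier_bounded.
have b0 : 0 <= b by lra.
(* This bounds every product of two functions taken among the fixed bump and the windows. *)
exists (b * b); first by rewrite mulr_ge0.
move=> u v00 v10 v01 v11 cu w00 w10 w01 w11 z0 z01.
(* The width [d] depends on the error [e], but the constant does not depend on [d], so [e] may tend
   to 0. *)
apply/lee_addgt0Pr => /= e e0.
have [d d01 ue] := near_box z0 cu e0.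
have [d0 d1] := andP d01; have [c1 c2] := disc_coords z01.
have mean := mean_near cu (ltW e0) d01 z01 ue.
set chi := mollifier (1 : R) 0 in chib.
have schi : smooth_on setT chi by exact: smooth_mollifier.
have chin x : `|chi x| <= b by rewrite ger0_norm ?mollifier_ge0.
pose P1 := window d z0.1; pose P2 := window d z0.2.
have sP1 : smooth_on setT P1 by exact: smooth_window.
have sP2 : smooth_on setT P2 by exact: smooth_window.
have P1b x : `|P1 x| <= b by apply: le_trans b1; exact: window_le1.
have P2b x : `|P2 x| <= b by apply: le_trans b1; exact: window_le1.
have tb F G : (forall x, `|F x| <= b) -> (forall x, `|G x| <= b) ->
  forall z, `|tensor F G z| <= b * b.
  by move=> Fb Gb z; rewrite /tensor normrM ler_pM.
pose D1 x := mollifier d z0.1 x - chi x; pose D2 x := mollifier d z0.2 x - chi x.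
have D1E : 'D_1 P1 = D1 by exact: derive_window.
have D2E : 'D_1 P2 = D2 by exact: derive_window.
have sD1 : smooth_on setT D1 by rewrite -D1E; exact: smooth_derive.
have sD2 : smooth_on setT D2 by rewrite -D2E; exact: smooth_derive.
have E11 : partial 1 1 (tensor P1 P2) = tensor D1 D2.
  change ('D_(1, 0) ('D_(0, 1) (tensor P1 P2)) = tensor D1 D2).
  by rewrite (derive_tensor2 sP1 sP2) D2E (derive_tensor1 sP1 sD2) D1E.
have E10 : partial 1 0 (tensor P1 chi) = tensor D1 chi.
  by rewrite -D1E; exact: derive_tensor1.
have E01 : partial 0 1 (tensor chi P2) = tensor chi D2.
  by rewrite -D2E; exact: derive_tensor2.
have P10 := window_out d0 d1 c1; have P20 := window_out d0 d1 c2.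
have chi0 : forall x, 7 / 5 <= `|x| -> chi x = 0 by exact: mollifier1_support.
have B11 := weak_bound w11 sP1 sP2 P10 P20 (tb _ _ P1b P2b).
have B10 := weak_bound w10 sP1 schi P10 chi0 (tb _ _ P1b chin).
have B01 := weak_bound w01 schi sP2 chi0 P20 (tb _ _ chin P2b).
have B00 := weak_bound w00 schi schi chi0 chi0 (tb _ _ chin chin).
rewrite E11 in B11; rewrite E10 in B10; rewrite E01 in B01.
have D10 x : 7 / 5 <= `|x| -> D1 x = 0.
  by move=> x7; rewrite /D1 /chi mollifier_support// mollifier1_support// subrr.
have D20 x : 7 / 5 <= `|x| -> D2 x = 0.
  by move=> x7; rewrite /D2 /chi mollifier_support// mollifier1_support// subrr.
have int F G : smooth_on setT F -> smooth_on setT G ->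
  (forall x, 7 / 5 <= `|x| -> F x = 0) -> (forall x, 7 / 5 <= `|x| -> G x = 0) ->
  mu.-integrable setT (EFin \o (fun z => u z * tensor F G z)).
  move=> sF sG F0 G0; apply: (@integrable_continuous_support _ _ 2).
    move=> z; apply: cvgM; [exact: cu|].
    by apply: smooth_continuous; exact: smooth_tensor.
  by move=> z dz; rewrite tensor_support// mulr0.
have I11 := int _ _ sD1 sD2 D10 D20.
have I10 := int _ _ sD1 schi D10 mollifier1_support.
have I01 := int _ _ schi sD2 mollifier1_support D20.
have I00 := int _ _ schi schi mollifier1_support mollifier1_support.
have iadd (f g : R * R -> R) : mu.-integrable setT (EFin \o f) ->
    mu.-integrable setT (EFin \o g) -> mu.-integrable setT (EFin \o (fun z => f z + g z)).
  move=> fi gi; rewrite (_ : EFin \o _ = (EFin \o f) \+ (EFin \o g))%E.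
    exact: integrableD.
  by apply/funext.
(* Each narrow bump is [D1 + chi] or [D2 + chi]; expanding the product gives derivatives of orders
   (1,1), (1,0), (0,1) and (0,0). *)
have split_int : \int[mu]_z (u z * tensor (mollifier d z0.1) (mollifier d z0.2) z) =
    \int[mu]_z (u z * tensor D1 D2 z) + \int[mu]_z (u z * tensor D1 chi z) +
    \int[mu]_z (u z * tensor chi D2 z) + \int[mu]_z (u z * tensor chi chi z).
  have I2 := iadd _ _ I11 I10; have I3 := iadd _ _ I2 I01.
  rewrite -(RintegralD measurableT I11 I10) -(RintegralD measurableT I2 I01).
  rewrite -(RintegralD measurableT I3 I00).
  apply: eq_Rintegral => z _; rewrite /tensor /D1 /D2.
  move: (u z) (chi z.1) (chi z.2) (mollifier d z0.1 z.1) (mollifier d z0.2 z.2) => *.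
  ring.
rewrite split_int in mean.
apply: le_trans (leeD (leeD (leeD (leeD B11 B10) B01) B00) (lexx e%:E)).
rewrite -!EFinD lee_fin.
exact: ler_norm_add4.
Qed.

End tensor.

(** * Moebius transformations of the sphere *)

Section projective.
Context {R : realType}.
Local Notation C := (R[i]^o).
Implicit Types (X Y : C * C) (v : 'rV[R]_8).

Lemma complex_continuousD (T : topologicalType) (f g : T -> C) :
  continuous f -> continuous g -> continuous (fun x => f x + g x : C).
Proof. by move=> cf cg x; apply: cvgD; [exact: cf|exact: cg]. Qed.

Lemma complex_continuousM (T : topologicalType) (f g : T -> C) :
  continuous f -> continuous g -> continuous (fun x => f x * g x : C).
Proof. by move=> cf cg x; apply: cvgM; [exact: cf|exact: cg]. Qed.

Lemma complex_continuousB (T : topologicalType) (f g : T -> C) :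
  continuous f -> continuous g -> continuous (fun x => f x - g x : C).
Proof. by move=> cf cg x; apply: cvgB; [exact: cf|exact: cg]. Qed.

Lemma complex_continuous_cst (T : topologicalType) (a : C) : continuous (fun x : T => a).
Proof. by move=> x; exact: cvg_cst. Qed.

(** Homogeneous coordinates on CP^1; the zero vector receives the default value [None]. *)
Definition hproj (X : C * C) : sphere R :=
  if X.2 == 0 then None else Some (X.1 / X.2).

Lemma hproj_continuous X : X != 0 -> {for X, continuous hproj}.
Proof.
move=> X0; have [X20|X20] := eqVneq X.2 0.
  have X10 : X.1 != 0.
    by apply: contra_neq X0 => X10; rewrite (surjective_pairing X) X10 X20.
  rewrite /prop_for /continuous_at {2}/hproj X20 eqxx => V [K [cK _] KV].
  (* To leave a compact [K] of C: the inequality is open in [(z, Y)] and holds at [Y = X] for every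
     [z], so compactness makes it uniform over [K]. *)
  have : \forall Y \near X, K `<=` [set z | Y.1 - z * Y.2 != 0].
    move/compact_near_coveringP: cK => cK.
    apply: (cK _ (nbhs X) (fun (Y : C * C) z => Y.1 - z * Y.2 != 0)) => z _ /=.
    have h : (fun q : C * (C * C) => q.2.1 - q.1 * q.2.2) @ nbhs (z, X) --> (X.1 - z * X.2 : C).
      apply: cvgB; first by apply: cvg_comp; [exact: cvg_snd|exact: cvg_fst].
      by apply: cvgM; [exact: cvg_fst|apply: cvg_comp; [exact: cvg_snd|exact: cvg_snd]].
    have := @cvgr_neq0 _ _ _ _ _ _ _ h.
    by rewrite X20 mulr0 subr0 => /(_ _ X10); exact.
  apply: filterS => Y KY /=; apply: KV; rewrite /hproj.
  have [_|Y2] := eqVneq Y.2 0; first by right.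
  left; exists (Y.1 / Y.2) => // /KY /=.
  by rewrite mulfVK// subrr eqxx.
have nz : \forall Y \near X, Y.2 != 0 :> C.
  have h : (snd : C * C -> C) @ nbhs X --> (X.2 : C) by exact: cvg_snd.
  by have := @cvgr_neq0 _ _ _ _ _ _ _ h; move=> /(_ _ X20); exact.
rewrite /prop_for /continuous_at.
have -> : hproj X = Some (X.1 / X.2) by rewrite /hproj (negbTE X20).
apply: (@cvg_trans _ ((fun Y : C * C => Some (Y.1 / Y.2) : sphere R) @ X)).
  apply: near_eq_cvg; apply: filterS nz => Y Y2.
  by rewrite /hproj (negbTE Y2).
apply: (@continuous_comp _ _ _ (fun Y : C * C => Y.1 / Y.2 : C) (Some : C -> sphere R)).
  apply: cvgM; first exact: cvg_fst.
  by apply: cvgV => //; exact: cvg_snd.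
exact: one_point_compactification_some_continuous.
Qed.

Lemma realC_continuous : continuous (fun x : R => x%:C%C : C).
Proof.
move=> x; apply/cvgrPdist_lt => e e0.
have eE : e = (complex.Re e)%:C%C by rewrite RRe_real// gtr0_real.
have e0' : 0 < complex.Re e by move: e0; rewrite {1}eE ltcR.
near=> y.
rewrite -rmorphB /= normc_def/= expr0n addr0 sqrtr_sqr eE ltcR.
near: y; exact: cvgr_dist_lt.
Unshelve. all: by end_near. Qed.

Lemma complex_continuous : continuous (fun z : R * R => (z.1 +i* z.2)%C : C).
Proof.
move=> z.
have -> : (fun z : R * R => (z.1 +i* z.2)%C : C) =
   (fun z => z.1%:C%C + 'i%C * z.2%:C%C).
  by apply/funext => -[a b] /=; rewrite [LHS]complexE.
apply: cvgD; last apply: cvgM; [|exact: cvg_cst|].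
  by apply: (@cvg_comp _ _ _ fst); [exact: cvg_fst|exact: realC_continuous].
by apply: (@cvg_comp _ _ _ snd); [exact: cvg_snd|exact: realC_continuous].
Qed.

Lemma hproj_surj x : exists2 X, X != 0 & hproj X = x.
Proof.
case: x => [z|].
  exists (z, 1); last by rewrite /hproj/= oner_eq0 divr1.
  by rewrite xpair_eqE oner_eq0 andbF.
exists (1, 0); last by rewrite /hproj eqxx.
by rewrite xpair_eqE oner_eq0.
Qed.

Lemma hproj_parallel X Y : X != 0 -> Y != 0 -> X.1 * Y.2 = X.2 * Y.1 ->
  hproj X = hproj Y.
Proof.
case: X Y => [x1 x2] [y1 y2]; rewrite !xpair_eqE /hproj /=.
have [->|x20] := eqVneq x2 0; have [->|y20] := eqVneq y2 0 => //=.
- by rewrite andbT mul0r => x10 _ /eqP; rewrite mulf_eq0 (negbTE x10) (negbTE y20).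
- by rewrite andbT mulr0 => _ y10 /esym/eqP; rewrite mulf_eq0 (negbTE y10) (negbTE x20).
move=> _ _ e; congr Some; apply/eqP.
by rewrite eqr_div// e mulrC.
Qed.

(** Lifts of the charts to nonzero vectors: continuity of the charts, also at the point at infinity,
    reduces to that of [hproj]. *)
Definition charts_hproj (i : bool) (z : R * R) : C * C :=
  if i then (1, (z.1 +i* z.2)%C) else ((z.1 +i* z.2)%C, 1).

Lemma sphere_chartE i z : sphere_chart i z = hproj (charts_hproj i z).
Proof.
case: i; rewrite /hproj /charts_hproj /sphere_chart /=; last by rewrite oner_eq0 divr1.
case: z => a b; rewrite xpair_eqE eq_complex /=; case: ifP => //.
by rewrite div1r.
Qed.

Lemma sphere_chart_continuous i : continuous (@sphere_chart R i).
Proof.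
move=> z; rewrite (_ : sphere_chart i = hproj \o charts_hproj i); last first.
  by apply/funext => w; rewrite sphere_chartE.
apply: continuous_comp.
  by case: i => /=; apply: (@cvg_pair _ _ _ _ (nbhs _) (nbhs _)) => /=;
    (exact: cvg_cst || exact: complex_continuous).
apply: hproj_continuous.
by case: i; rewrite /charts_hproj xpair_eqE oner_eq0 ?andbF.
Qed.

(** Either [z] or its inverse has modulus at most 1. Unit discs thus suffice, which leaves room for
    test functions inside the discs of radius 2. *)
Lemma sphere_chart_surj x :
  exists i, exists2 z : R * R, z.1 ^+ 2 + z.2 ^+ 2 <= 1 & sphere_chart i z = x.
Proof.
case: x => [[a b]|].
  have [ab|ab] := leP (a ^+ 2 + b ^+ 2) 1.
    by exists false; exists (a, b).
  have s0 : 0 < a ^+ 2 + b ^+ 2 by rewrite (lt_trans _ ab).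
  (* The real and imaginary parts of the inverse of [a + i b]. *)
  exists true; exists (a / (a ^+ 2 + b ^+ 2), - (b / (a ^+ 2 + b ^+ 2))).
    rewrite /= sqrrN !expr_div_n -mulrDl expr2 invfM mulrA mulfV ?gt_eqF// mul1r.
    by rewrite invf_le1// ltW.
  rewrite /sphere_chart /= xpair_eqE oppr_eq0 !mulf_eq0 !invr_eq0 (gt_eqF s0) !orbF.
  case: ifPn => [/andP[/eqP a0 /eqP b0]|_].
    by move: s0; rewrite a0 b0 expr0n addr0 ltxx.
  by congr Some; rewrite -[RHS]invrK; congr (_^-1).
by exists true; exists (0, 0); rewrite /sphere_chart/= ?eqxx// expr0n addr0.
Qed.


(* Real coordinates on the complex 2 x 2 matrices: row vectors over [R] have a
   real norm and the Heine-Borel property. *)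
Definition cmat v : 'M[C]_2 :=
  \matrix_(i, j) ((v 0 (inord (4 * i + 2 * j)))%:C +
                  'i * (v 0 (inord (4 * i + 2 * j + 1)))%:C)%C.

Lemma cmat_entry_continuous i j : continuous (fun v => cmat v i j : C).
Proof.
have -> : (fun v => cmat v i j : C) = (fun v =>
   (v 0 (inord (4 * i + 2 * j)))%:C%C + 'i%C * (v 0 (inord (4 * i + 2 * j + 1)))%:C%C).
  by apply/funext => w; rewrite mxE.
have h k : continuous (fun v : 'rV[R]_8 => (v 0 k)%:C%C : C).
  move=> v; apply: (@continuous_comp _ _ _ (fun v : 'rV[R]_8 => v 0 k : R)
    (fun x : R => x%:C%C : C)); last exact: realC_continuous.
  exact: coord_continuous.
apply: complex_continuousD; first exact: h.
by apply: complex_continuousM; [exact: complex_continuous_cst|exact: h].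
Qed.

Lemma cmat_surj (A : 'M[C]_2) : exists v, cmat v = A.
Proof.
(* Decoding of the index: [k %/ 4] is the row, [(k %% 4) %/ 2] the column, and the parity selects
   the real or imaginary part. *)
exists (\row_(k < 8) let z : R[i] := A (inord (k %/ 4)) (inord ((k %% 4) %/ 2)) in
   if odd k then complex.Im z else complex.Re z).
apply/matrixP => i j; rewrite !mxE.
case: i => -[|[|//]] hi; case: j => -[|[|//]] hj; rewrite !inordK//= -complexE;
 congr (A _ _); apply/val_inj => /=; rewrite inordK//.
Qed.

Lemma cmat_eq0 v : cmat v = 0 -> v = 0.
Proof.
move=> /matrixP v0.
have h (i j : 'I_2) : v 0 (inord (4 * i + 2 * j)) = 0 /\
    v 0 (inord (4 * i + 2 * j + 1)) = 0.
  have := v0 i j; rewrite !mxE; move=> e.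
  have : (0 : R[i]) = (v 0 (inord (4 * i + 2 * j)) +i* v 0 (inord (4 * i + 2 * j + 1)))%C.
    by rewrite [RHS]complexE /= e.
  by case.
apply/rowP => k; rewrite mxE -[k]inord_val.
have [] := h (inord (k %/ 4)) (inord ((k %% 4) %/ 2)).
by case: k => -[|[|[|[|[|[|[|[|//]]]]]]]] hk /=; rewrite !inordK.
Qed.

Lemma cmatZ (t : R) v : cmat (t *: v) = t%:C%C *: cmat v.
Proof.
by apply/matrixP => i j; rewrite !mxE !rmorphM mulrDr mulrCA.
Qed.

(** The linear lift of the Moebius action to C^2, meaningful also for the singular limit
    matrices. *)
Definition act v X : C * C :=
  (cmat v 0 0 * X.1 + cmat v 0 1 * X.2, cmat v 1 0 * X.1 + cmat v 1 1 * X.2).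

Lemma actZ (t : R) v X : act (t *: v) X = t%:C%C *: act v X.
Proof.
rewrite /act cmatZ !mxE; congr pair;
by rewrite /= [RHS]mulrDr !mulrA.
Qed.

Lemma actDr v X Y (t : C) : act v (X + t *: Y) = act v X + t *: act v Y.
Proof.
rewrite /act; congr pair; rewrite /= /GRing.scale /=; ring.
Qed.

Lemma hprojZ (t : C) X : t != 0 -> hproj (t *: X) = hproj X.
Proof.
move=> t0; rewrite /hproj /= mulf_eq0 (negbTE t0) /=; case: ifP => // _.
by congr Some; rewrite -mulf_div divff// mul1r.
Qed.

Lemma act_continuous X : continuous (act^~ X).
Proof.
have h i (x y : C) : continuous (fun v => cmat v i 0 * x + cmat v i 1 * y : C).
  by apply: complex_continuousD; apply: complex_continuousM; try exact: complex_continuous_cst;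
  exact: cmat_entry_continuous.
move=> v; have h1 := h 0 X.1 X.2 v; have h2 := h 1 X.1 X.2 v.
exact: (cvg_pair h1 h2).
Qed.

Lemma det_mx2 (A : 'M[C]_2) : \det A = A 0 0 * A 1 1 - A 0 1 * A 1 0.
Proof.
rewrite (expand_det_row _ 0) !big_ord_recl big_ord0 /cofactor !det_mx11 !mxE /=.
rewrite !expr0 expr1 mul1r addr0 mulN1r mulrN; congr (A _ _ * A _ _ - A _ _ * A _ _);
  exact/val_inj.
Qed.

Lemma det_cmat_continuous : continuous (fun v => \det (cmat v) : C).
Proof.
rewrite (_ : (fun v => \det (cmat v)) =
    fun v => cmat v 0 0 * cmat v 1 1 - cmat v 0 1 * cmat v 1 0); last first.
  by apply/funext => u; rewrite det_mx2.
by apply: complex_continuousB; apply: complex_continuousM; exact: cmat_entry_continuous.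
Qed.

Lemma act_eq0 v X : \det (cmat v) != 0 -> act v X = 0 -> X = 0.
Proof.
rewrite det_mx2; case: X => x1 x2; rewrite /act/= => d0 [e1 e2].
have h1 : (cmat v 0 0 * cmat v 1 1 - cmat v 0 1 * cmat v 1 0) * x1 = 0.
  transitivity (cmat v 1 1 * (cmat v 0 0 * x1 + cmat v 0 1 * x2) -
    cmat v 0 1 * (cmat v 1 0 * x1 + cmat v 1 1 * x2)); first by ring.
  by rewrite e1 e2; ring.
have h2 : (cmat v 0 0 * cmat v 1 1 - cmat v 0 1 * cmat v 1 0) * x2 = 0.
  transitivity (cmat v 0 0 * (cmat v 1 0 * x1 + cmat v 1 1 * x2) -
    cmat v 1 0 * (cmat v 0 0 * x1 + cmat v 0 1 * x2)); first by ring.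
  by rewrite e1 e2; ring.
move/eqP: h1; rewrite mulf_eq0 (negbTE d0) /= => /eqP ->.
by move/eqP: h2; rewrite mulf_eq0 (negbTE d0) /= => /eqP ->.
Qed.

(** The determinant of the pair of images is [\det (cmat v)] times that of [X] and [Y]; a singular
    matrix maps everything into one line. *)
Lemma act_parallel v X Y : \det (cmat v) = 0 ->
  (act v X).1 * (act v Y).2 = (act v X).2 * (act v Y).1.
Proof.
rewrite det_mx2 /act /= => d0; apply/eqP; rewrite -subr_eq0; apply/eqP.
transitivity ((cmat v 0 0 * cmat v 1 1 - cmat v 0 1 * cmat v 1 0) * (X.1 * Y.2 - X.2 * Y.1)).
  by ring.
by rewrite d0 mul0r.
Qed.

Lemma actZr v (t : C) X : act v (t *: X) = t *: act v X.
Proof.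
by rewrite /act; congr pair; rewrite /= /GRing.scale /=; ring.
Qed.

(** Both sides are invariant under scaling of [X], which reduces the claim to the vectors (1, 0) and
    (z, 1). *)
Lemma mobius_hproj v X : X != 0 ->
  mobius (cmat v) (hproj X) = hproj (act v X).
Proof.
case: X => x1 x2 X0; have [x20|x20] := eqVneq x2 0.
  have x10 : x1 != 0 by move: X0; rewrite xpair_eqE x20 eqxx andbT.
  have -> : (x1, x2) = x1 *: ((1, 0) : C * C).
    by rewrite x20; congr pair; rewrite /GRing.scale/= ?mulr1 ?mulr0.
  rewrite actZr !hprojZ// /hproj eqxx /act /= !mulr1 !mulr0 !addr0.
  by [].
have -> : (x1, x2) = x2 *: ((x1 / x2, 1) : C * C).
  by congr pair; rewrite /GRing.scale/= ?mulr1// mulrC divfK.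
rewrite actZr !hprojZ// /hproj /act /= oner_eq0 divr1 !mulr1.
by [].
Qed.

(** Properness of the action, seen through one real coordinate. The hypothesis on [x] and [y] says
    that no number is within [r] of both values of [phi]. *)
Lemma proper_mobius (phi : sphere R -> R) (r : R) x y :
  continuous phi -> 2 * r < `|phi x - phi y| ->
  exists N : R, forall v, \det (cmat v) = 1 ->
    (forall x, `|phi (mobius (cmat v) x) - phi x| <= r) -> `|v| <= N.
Proof.
move=> cphi rxy; apply: contrapT => nN.
(* The shift to [N.+1] makes every norm exceed 1, so that normalizing is possible. *)
have /choice[v vP] : forall N : nat, exists v, [/\ \det (cmat v) = 1,
    (forall x, `|phi (mobius (cmat v) x) - phi x| <= r) & N.+1%:R < `|v|].
  move=> N; apply: contrapT => nv; apply: nN; exists N.+1%:R => v dv hv.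
  by rewrite leNgt; apply/negP => Nv; apply: nv; exists v.
have vpos N : 0 < `|v N| by have [_ _] := vP N; exact: le_lt_trans.
pose w N := `|v N|^-1 *: v N.
have w1 N : `|w N| = 1.
  by rewrite normrZ normfV normr_id mulVf// gt_eqF.
have cS : compact [set u : 'rV[R]_8 | `|u| = 1].
  apply: bounded_closed_compact.
    by exists 1; split => // M M1 u /= ->; rewrite ltW.
  rewrite (_ : [set u | _] = Num.norm @^-1` [set 1 : R])//.
  apply: (@closed_comp _ _ (fun u : 'rV[R]_8 => `|u| : R)); last exact: closed_eq.
  by move=> u _; exact: norm_continuous.
have [|b []/= b1] := cS (w @ \oo) _; first by exists 0%N => // N _; exact: w1.
(* The finer filter [G], converging to [b], plays the role of a convergent subsequence. *)
rewrite cluster_cvgE /= => -[G PG [Gb wG]].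
(* Scaling a matrix does not change its action on CP^1, so the estimate for [v N] holds for [w N],
   hence along [G]. *)
have phiw X : X != 0 -> \forall u \near G, `|phi (hproj (act u X)) - phi (hproj X)| <= r.
  move=> X0; apply: wG; exists 0%N => // N _ /=.
  have [_ /(_ (hproj X)) + _] := vP N.
  rewrite mobius_hproj// actZ hprojZ//.
  by rewrite eq_complex /= eqxx andbT invr_eq0 gt_eqF.
have phib X : X != 0 -> act b X != 0 -> `|phi (hproj (act b X)) - phi (hproj X)| <= r.
  move=> X0 bX0; apply: (@closed_cvg _ _ G _ (fun u => `|phi (hproj (act u X)) - phi (hproj X)|)
    [set z | z <= r]); [exact: closed_le|exact: phiw|].
  apply: cvg_norm; apply: cvgB; last exact: cvg_cst.
  apply: (cvg_comp (fun u => act u X) (phi \o hproj)).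
    exact: cvg_trans (cvg_app _ Gb) (@act_continuous X b).
  have : {for act b X, continuous (phi \o hproj)}.
    by apply: continuous_comp; [exact: hproj_continuous|exact: cphi].
  exact.
(* The determinant of [w N] is the inverse square of [|v N|], which is dominated by the harmonic
   sequence. *)
have detb : \det (cmat b) = 0.
  have h1 : (fun u => \det (cmat u) : C) @ G --> (\det (cmat b) : C).
    exact: cvg_trans (cvg_app _ Gb) (@det_cmat_continuous b).
  have h2 : (fun u => \det (cmat u) : C) @ G --> (0 : C).
    apply: (@cvg_trans _ ((fun N => \det (cmat (w N)) : C) @ \oo)).
      by move=> A /= hA; apply: wG.
    rewrite (_ : (fun N => _) = fun N => (`|v N|^-1 ^+ 2)%:C%C); last first.
      apply/funext => N; rewrite cmatZ detZ; have [-> _ _] := vP N.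
      by rewrite mulr1 rmorphXn.
    apply: (@cvg_comp _ _ _ (fun N => `|v N|^-1 ^+ 2) (fun x : R => x%:C%C : C)
      _ (nbhs (0 : R))); last exact: realC_continuous.
    apply: (@squeeze_cvgr _ _ _ _ (fun=> 0) (@harmonic R)).
    - near=> N; rewrite exprn_ge0 ?invr_ge0//=; have [_ _ Nv] := vP N.
      rewrite expr2 -invfM lef_pV2 ?posrE ?mulr_gt0//.
      have : 1 <= `|v N| by apply: le_trans (ltW Nv); rewrite ler1n.
      by nra.
    - exact: cvg_cst.
    - exact: cvg_harmonic.
  exact: cvg_unique h1 h2.
(* A nonzero matrix cannot kill both basis vectors. *)
have [X1 X10 bX1] : exists2 X, X != 0 & act b X != 0.
  apply: contrapT => nX.
  have actb X : X != 0 -> act b X = 0.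
    by move=> X0; apply/eqP/negP => /negP bX; apply: nX; exists X.
  have e10 := actb (1, 0); have e01 := actb (0, 1).
  have b0 : cmat b = 0.
    move: e10 e01; rewrite !xpair_eqE oner_eq0 andbF /= => /(_ isT) + /(_ isT).
    rewrite /act /= !mulr1 !mulr0 !addr0 !add0r => -[e1 e2] [e3 e4].
    apply/matrixP => i j; rewrite [RHS]mxE.
    by case: i => -[|[|//]] hi; case: j => -[|[|//]] hj;
      [rewrite -e1|rewrite -e3|rewrite -e2|rewrite -e4]; congr (cmat b _ _);
      exact/val_inj.
  by move: b1; rewrite (cmat_eq0 b0) normr0 => /esym/eqP; rewrite oner_eq0.
(* By [act_parallel], this is the value of [phi] at the image of every vector outside the kernel of
   [b]. *)
pose c := phi (hproj (act b X1)).
have near_c X : X != 0 -> `|c - phi (hproj X)| <= r.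
  move=> X0; have [bX|bX] := eqVneq (act b X) 0; last first.
    rewrite /c (_ : hproj (act b X1) = hproj (act b X)); first exact: phib.
    by apply: hproj_parallel => //; exact: act_parallel.
  (* A vector [X] of the kernel is the limit of [X + t *: X1], which is outside the kernel for
     [t != 0]. *)
  have cX : (fun t : C => X + t *: X1) @ (0 : C)^' --> X.
    apply: (@cvg_trans _ ((fun t : C => X + t *: X1) @ nbhs (0 : C))).
      by apply: cvg_app; exact: cvg_within.
    have : (fun t : C => X + t *: X1) @ nbhs (0 : C) --> X + (0 : C) *: X1.
      by apply: cvgD; [exact: cvg_cst|apply: cvgZr_tmp; exact: cvg_id].
    by rewrite scale0r addr0.
  apply: (@closed_cvg _ _ (0 : C)^' _ (fun t : C => `|c - phi (hproj (X + t *: X1))|)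
    [set z | z <= r]); [exact: closed_le| |].
    near=> t.
    have t0 : t != 0 by near: t; exact: nbhs_dnbhs_neq.
    have bXt : act b (X + t *: X1) != 0.
      by rewrite actDr bX add0r scaler_eq0 negb_or t0.
    rewrite /= /c (_ : hproj (act b X1) = hproj (act b (X + t *: X1))).
      apply: phib => //; apply: contra_neq bXt => ->.
      by rewrite /act /= !mulr0 addr0.
    by apply: hproj_parallel => //; exact: act_parallel.
  apply: cvg_norm; apply: cvgB; first exact: cvg_cst.
  apply: (cvg_comp _ (phi \o hproj) cX).
  have : {for X, continuous (phi \o hproj)}.
    by apply: continuous_comp; [exact: hproj_continuous|exact: cphi].
  exact.
move: rxy; rewrite ltNge => /negP; apply.
have [X X0 <-] := hproj_surj x; have [Y Y0 <-] := hproj_surj y.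
have := near_c _ X0; have := near_c _ Y0.
rewrite !ler_norml; lra.
Unshelve. all: by end_near. Qed.

End projective.

(** * Compactness of the bounded parts of the reparametrization groups *)

Section compactness.
Local Open Scope quotient_scope.
Context {R : realType}.
Local Notation C := (R[i]^o).
Implicit Types (v : 'rV[R]_8).

Let closed1C (a : C) : closed [set a].
Proof.
by apply: accessible_closed_set1; apply: hausdorff_accessible; exact: norm_hausdorff.
Qed.

Lemma cmat_continuous : continuous (fun v => cmat v : 'M[C]_2).
Proof.
move=> v A [P vP PA]; apply: (@filterS _ (nbhs v) _ (fun w => forall i j, P i j (cmat w i j))).
  by move=> w Pw; apply: PA.
apply: (@filter_forall _ _ _ (nbhs v)) => i; apply: (@filter_forall _ _ _ (nbhs v)) => j.
exact: (@cmat_entry_continuous R i j v _ (vP i j)).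
Qed.

Definition sl2_one : @SL2 R := SigSub (mem_set (det1 _ _ : @SL2 R 1%:M)).

(** Meaningful for determinant 1; any other matrix is sent to the identity. *)
Definition to_SL2 v : @SL2 R := insubd sl2_one (cmat v).

Definition to_PSL2 v : PSL2 R := \pi_{eq_quot (@SL2_eqv R)} (to_SL2 v).

Lemma to_SL2K v : \det (cmat v) = 1 -> \val (to_SL2 v) = cmat v.
Proof. by move=> dv; rewrite /to_SL2 insubdK// inE. Qed.

Lemma to_PSL2_surj (g : PSL2 R) : exists2 v, \det (cmat v) = 1 & to_PSL2 v = g.
Proof.
pose A := repr (g : {eq_quot (@SL2_eqv R)}).
have [v vA] := cmat_surj (\val A); exists v.
  by rewrite vA; case: (A) => B /= /set_mem.
rewrite /to_PSL2 -[RHS](@reprK _ {eq_quot (@SL2_eqv R)} g); congr (\pi _).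
by apply/val_inj; rewrite to_SL2K ?vA//; case: (A) => B /= /set_mem.
Qed.

Lemma reparam_to_PSL2 v : \det (cmat v) = 1 -> reparam (to_PSL2 v) =1 mobius (cmat v).
Proof. by move=> dv x; rewrite /to_PSL2 reparam_pi to_SL2K. Qed.

Lemma closed_det1 : closed [set v | \det (cmat v) = 1 :> C].
Proof.
rewrite (_ : [set _ | _] = (fun v => \det (cmat v) : C) @^-1` [set 1])//.
apply: closed_comp; last exact: closed1C.
by move=> v _; exact: det_cmat_continuous.
Qed.

(** Fixing the class of [X] means that [act v X] is parallel to [X], an equation whose two sides are
    continuous in [v]. *)
Lemma closed_stabilizer x :
  closed [set v | \det (cmat v) = 1 /\ stabilizer x (to_PSL2 v)].
Proof.
have [X X0 Xx] := hproj_surj x.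
rewrite (_ : [set _ | _] = [set v | \det (cmat v) = 1 :> C] `&`
  ((fun v => (act v X).1 * X.2 - (act v X).2 * X.1 : C) @^-1` [set 0])).
  apply: closedI; first exact: closed_det1.
  apply: closed_comp; last exact: closed1C.
  have c1 : continuous (fun v => (act v X).1 : C).
    by move=> v; apply: (@continuous_comp _ _ _ (fun v => act v X) fst);
      [exact: act_continuous|exact: cvg_fst].
  have c2 : continuous (fun v => (act v X).2 : C).
    by move=> v; apply: (@continuous_comp _ _ _ (fun v => act v X) snd);
      [exact: act_continuous|exact: cvg_snd].
  have c : continuous (fun v => (act v X).1 * X.2 - (act v X).2 * X.1 : C).
    apply: complex_continuousB.
      apply: (complex_continuousM c1); exact: complex_continuous_cst.
    apply: (complex_continuousM c2); exact: complex_continuous_cst.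
  by move=> v _; exact: c.
apply/seteqP; split => v /= [dv h]; (split; first by []).
  change ((act v X).1 * X.2 - (act v X).2 * X.1 = 0 :> C).
  have : hproj (act v X) = hproj X.
    by rewrite -mobius_hproj// -reparam_to_PSL2// Xx.
  rewrite /hproj; case: ifPn => [/eqP e1|e1]; case: ifPn => [/eqP e2|e2] //.
    by rewrite e1 e2 mulr0 mul0r subrr.
  by move=> [e]; apply/eqP; rewrite subr_eq0 [X in _ == X]mulrC -eqr_div// e.
rewrite /stabilizer/= reparam_to_PSL2// -Xx mobius_hproj//.
apply: hproj_parallel => //.
  by apply: contra_neq X0; apply: act_eq0; rewrite dv oner_neq0.
by apply/eqP; rewrite -subr_eq0 h.
Qed.

Lemma compact_reparam_group (G : set (PSL2 R)) (N : R) : reparam_group G ->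
  compact (to_PSL2 @` [set v | [/\ `|v| <= N, \det (cmat v) = 1 & G (to_PSL2 v)]]).
Proof.
move=> hG.
have clG : closed [set v | \det (cmat v) = 1 /\ G (to_PSL2 v)].
  case: hG => [->|[x1 ->]|[x1 [x2 [_ ->]]]].
  - by rewrite (_ : [set _ | _] = [set v | \det (cmat v) = 1 :> C]);
      [exact: closed_det1|apply/seteqP; split => v /= []].
  - exact: closed_stabilizer.
  - rewrite (_ : [set _ | _] = [set v | \det (cmat v) = 1 /\ stabilizer x1 (to_PSL2 v)]
      `&` [set v | \det (cmat v) = 1 /\ stabilizer x2 (to_PSL2 v)]).
      by apply: closedI; exact: closed_stabilizer.
    by apply/seteqP; split => v /= [] => [? []|[? ?] []].
set K := [set v | _].
have cK : compact K.
  apply: bounded_closed_compact.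
    exists N; split; first exact: num_real.
    by move=> M NM v /= [vN _ _]; rewrite (le_trans vN)// ltW.
  rewrite (_ : K = (Num.norm @^-1` [set x : R | x <= N]) `&`
     [set v | \det (cmat v) = 1 /\ G (to_PSL2 v)]).
    apply: closedI => //.
    apply: (@closed_comp _ _ (fun u : 'rV[R]_8 => `|u| : R)); last exact: closed_le.
    by move=> u _; exact: norm_continuous.
  by apply/seteqP; split => v /= [] // ? [].
apply: continuous_compact => //.
(* Because of the default value, [to_SL2] is considered on [K] only, where it agrees with [cmat]. *)
have cS : continuous (to_SL2 : subspace K -> @SL2 R).
  apply: continuous_comp_initial.
  have : {within K, continuous cmat}.
    by apply: continuous_subspaceT; exact: cmat_continuous.
  by apply: subspace_eq_continuous => v /set_mem [_ dv _] ;
    exact: esym (to_SL2K dv).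
move=> v; apply: (@continuous_comp (subspace K) _ _ to_SL2); first exact: cS.
exact: pi_continuous.
Qed.

End compactness.

(** * Uniform smallness and the theorem *)

Section sup_bound.
Context {R : realType}.
Implicit Types (u v : R * R -> R).
Local Notation mu := (@lebesgue2 R).

(** The strict inequality describes an open set, so a function vanishing there vanishes near each of
    its points and has zero derivatives there. *)
Lemma iter_derive_support (phi : R * R -> R) (r : R) vs :
  (forall z, ~ disc r z -> phi z = 0) ->
  forall z, r ^+ 2 < z.1 ^+ 2 + z.2 ^+ 2 -> iter_derive vs phi z = 0.
Proof.
move=> phi0; elim: vs => [|v vs IH] z rz /=.
  by apply: phi0; rewrite /disc/= => /lt_trans/(_ rz); rewrite ltxx.
rewrite (near_eq_derive (g := cst 0)) ?derive_cst//.
near=> w; apply: IH; near: w.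
have : open ((fun z : R * R => z.1 ^+ 2 + z.2 ^+ 2) @^-1` [set x | r ^+ 2 < x]).
  apply: open_comp => [w _|]; last exact: open_gt.
  apply: cvgD; rewrite !expr2; apply: cvgM; first [exact: cvg_fst|exact: cvg_snd].
by move=> oU; apply: (@open_nbhs_nbhs _ z); split.
Unshelve. all: by end_near. Qed.

Lemma Lp_loc1B v1 v2 : Lp_loc 1 v1 -> Lp_loc 1 v2 -> Lp_loc 1 (v1 \- v2).
Proof.
move=> l1 l2; have [m1 _] := l1; have [m2 _] := l2.
split; first exact: measurable_funB.
move=> r; rewrite Lp_norm_disc1.
have i1 := Lp_loc1_integrable r l1; have i2 := Lp_loc1_integrable r l2.
have /integrableP[_] := integrableB measurableT i1 i2.
congr (_ < _)%E; apply: eq_integral => z _; rewrite /= !patchE.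
by case: ifPn => _; rewrite /= ?subr0.
Qed.

(** Continuity of [u1] and [u2] makes their products with derivatives of test functions integrable,
    so the integrals may be split. *)
Lemma is_weak_partialB a b u1 u2 v1 v2 : continuous u1 -> continuous u2 ->
  is_weak_partial a b u1 v1 -> is_weak_partial a b u2 v2 ->
  is_weak_partial a b (u1 \- u2) (v1 \- v2).
Proof.
move=> c1 c2 [l1 w1] [l2 w2]; split; first exact: Lp_loc1B.
move=> phi tphi; have [sphi [r phi0]] := tphi.
have [cphi cpart] : continuous phi /\ continuous (partial a b phi).
  split=> z; first by have [] := sphi [::] z I.
  by have [_] := sphi (nseq a (1, 0) ++ nseq b (0, 1)) z I.
(* The radius is enlarged because [iter_derive_support] says nothing on the boundary circle. *)
have part0 z : ~ disc (`|r| + 1) z -> partial a b phi z = 0.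
  move=> /negP; rewrite -leNgt => rz; apply: iter_derive_support phi0 _ _.
  apply: lt_le_trans rz; rewrite -real_normK ?num_real//.
  by rewrite ltrXn2r// ltrDl.
have iu u : continuous u -> mu.-integrable setT (EFin \o (fun z => u z * partial a b phi z)).
  move=> cu; apply: (@integrable_continuous_support _ _ (`|r| + 1)).
    by move=> z; apply: cvgM; [exact: cu|exact: cpart].
  by move=> z /part0 ->; rewrite mulr0.
have [B phiB] := bounded_continuous_support cphi phi0.
have iv v : Lp_loc 1 v -> mu.-integrable setT (EFin \o (fun z => v z * phi z)).
  move=> lv.
  by have [] := integrable_weak lv (continuous_measurable2 cphi) phiB phi0.
under eq_Rintegral do rewrite mulrBl.
rewrite (RintegralB measurableT (iu _ c1) (iu _ c2)) w1// w2// -mulrBr.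
rewrite -(RintegralB measurableT (iv _ l1) (iv _ l2)).
by congr (_ * _); apply: eq_Rintegral => z _; rewrite mulrBl.
Qed.

Lemma weak_partialP a b u v :
  is_weak_partial a b u v -> is_weak_partial a b u (weak_partial a b u).
Proof.
by move=> uv; apply: (@xgetPex _ (fun=> 0) [set v | is_weak_partial a b u v]); exists v.
Qed.

Lemma Lp_norm_le_sobolev k (p : R) a b u : (a + b <= k)%N ->
  (Lp_norm_disc p 2 (weak_partial a b u) <= sobolev_norm_disc k p 2 u)%E.
Proof.
move=> abk; rewrite /sobolev_norm_disc.
have ak : (a < k.+1)%N by rewrite ltnS (leq_trans _ abk)// leq_addr.
have bk : (b < k.+1)%N by rewrite ltnS (leq_trans _ abk)// leq_addl.
rewrite (bigD1 (Ordinal ak))//= (bigD1 (Ordinal bk))//=.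
rewrite -addeA leeDl// adde_ge0//; first by apply: sume_ge0 => *; exact: Lnorm_ge0.
by apply: sume_ge0 => *; apply: sume_ge0 => *; exact: Lnorm_ge0.
Qed.

Lemma sobolev_sup k (p : R) : (1 < k)%N -> 1 <= p -> exists2 C : R, 0 <= C &
  forall u, continuous u -> (forall a b, (a + b <= k)%N -> exists v, is_weak_partial a b u v) ->
  forall z : R * R, z.1 ^+ 2 + z.2 ^+ 2 <= 1 ->
  (`|u z|%:E <= C%:E * sobolev_norm_disc k p 2 u)%E.
Proof.
move=> k1 p1; have [B B0 HB] := @sobolev_eval R; have [D D0 HD] := Lp_norm_disc_le p1.
(* [B] comes from the pointwise evaluation, [D] from the comparison of L^1 with L^p, and 4 counts
   the derivatives; that of order (1,1) enters the norm as [1 < k]. *)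
exists (4 * (B * D)); first by rewrite !mulr_ge0.
move=> u cu wu z z1.
have w a b : (a + b <= k)%N -> is_weak_partial a b u (weak_partial a b u).
  by move=> /wu[v]; exact: weak_partialP.
have w00 := w 0%N 0%N (ltnW (ltnW k1)); have w10 := w 1%N 0%N (ltnW k1).
have w01 := w 0%N 1%N (ltnW k1); have w11 := w 1%N 1%N k1.
apply: le_trans (HB _ _ _ _ _ cu w00 w10 w01 w11 z z1) _.
have bnd a b : (a + b <= k)%N -> (B%:E * Lp_norm_disc 1 2 (weak_partial a b u) <=
    (B * D)%:E * sobolev_norm_disc k p 2 u)%E.
  move=> abk; rewrite EFinM -muleA lee_wpmul2l//.
  apply: le_trans (HD _ _) _; first by have [[]] := w a b abk.
  by rewrite lee_wpmul2l//; exact: Lp_norm_le_sobolev.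
apply: le_trans (leeD (leeD (leeD (bnd 1%N 1%N k1) (bnd 1%N 0%N (ltnW k1)))
  (bnd 0%N 1%N (ltnW k1))) (bnd 0%N 0%N (ltnW (ltnW k1)))) _.
set N := sobolev_norm_disc _ _ _ _.
have N0 : (0 <= N)%E by apply: sume_ge0 => *; apply: sume_ge0 => *; exact: Lnorm_ge0.
have BD0 : 0 <= B * D by rewrite mulr_ge0.
rewrite -!ge0_muleDl ?lee_fin ?addr_ge0// -!EFinD.
by rewrite (_ : _ + _ = 4 * (B * D))//; ring.
Qed.

End sup_bound.

(** Near [x] the map factors through a chart, and smoothness with the empty list of directions is
    continuity. *)
Lemma embedding_continuous (R : realType) (n m : nat) (M : topologicalType)
    (X : riemannian_manifold R n M) (iota : M -> 'rV[R]_m) :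
  smooth_embedding X iota -> continuous iota.
Proof.
move=> emb x; have [c Xc cx] := atlas_cover X x.
have hc := atlas_chart Xc.
have nx : nbhs x (chart_dom c) by apply: open_nbhs_nbhs; split => //; exact: chart_dom_open hc.
have [_ ci] := embedding_smooth emb Xc [::] (ex_intro2 _ _ x cx erefl).
have cc : {for x, continuous (chart_map c)}.
  have := chart_map_continuous hc.
  rewrite continuous_open_subspace; last exact: chart_dom_open hc.
  by apply; rewrite inE.
have : {for x, continuous ((iota \o chart_inv c) \o chart_map c)}.
  exact: continuous_comp.
have e y : chart_dom c y -> ((iota \o chart_inv c) \o chart_map c) y = iota y.
  by move=> cy /=; rewrite (chart_mapK hc)// inE.
rewrite /prop_for /continuous_at e//.
apply: cvg_trans; apply: near_eq_cvg.
by apply: filterS nx => y /e.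
Qed.

(** * From the Sobolev distance to uniform distance *)

Section distance.
Context {R : realType} {M : topologicalType} {m : nat} (iota : M -> 'rV[R]_m).
Hypothesis ciota : continuous iota.

Lemma coord_map_continuous (f : sphere R -> M) j : continuous f ->
  continuous (fun x => iota (f x) ord0 j : R).
Proof.
move=> cf x.
apply: (@continuous_comp _ _ _ (fun x => iota (f x))
  (fun y : 'rV[R]_m => y ord0 j : R)).
  by apply: continuous_comp; [exact: cf|exact: ciota].
exact: coord_continuous.
Qed.

Lemma sobolev_dist_sup k (p : R) : (1 < k)%N -> 1 <= p -> exists2 C : R, 0 <= C &
  forall f h, sobolev_maps iota k p f -> sobolev_maps iota k p h ->
  forall x j, (`|iota (h x) ord0 j - iota (f x) ord0 j|%:E <=
    C%:E * sobolev_dist iota k p h f)%E.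
Proof.
move=> k1 p1; have [C C0 HC] := @sobolev_sup R k p k1 p1; exists C => //.
move=> f h [cf sf] [ch sh] x j.
have [i [z z1 <-]] := sphere_chart_surj x.
have crep g : continuous g -> continuous (local_rep iota g i j).
  move=> cg w; apply: (@continuous_comp _ _ _ (sphere_chart i) (fun x => iota (g x) ord0 j)).
    exact: sphere_chart_continuous.
  exact: coord_map_continuous.
apply: le_trans (HC (local_rep iota h i j \- local_rep iota f i j) _ _ z z1) _.
- by move=> w; apply: cvgB; exact: crep.
- move=> a b abk; have [v1 w1 _] := sh i j a b abk; have [v2 w2 _] := sf i j a b abk.
  by exists (v1 \- v2); apply: is_weak_partialB => //; exact: crep.
apply: lee_wpmul2l => //; rewrite /sobolev_dist (bigD1 i)//= (bigD1 j)//=.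
have S0 u : (0 <= sobolev_norm_disc k p 2 u)%E.
  by apply: sume_ge0 => *; apply: sume_ge0 => *; exact: Lnorm_ge0.
rewrite -addeA leeDl// adde_ge0//; first exact: sume_ge0.
by apply: sume_ge0 => *; exact: sume_ge0.
Qed.

(** The radius [eps] depends on [d] but not on the centre [f]. *)
Lemma sobolev_ball_close k (p : R) (d : R) : (1 < k)%N -> 1 <= p -> 0 < d ->
  exists2 eps : R, 0 < eps & forall f h, sobolev_maps iota k p f ->
    sobolev_ball iota k p f eps h ->
  forall x j, `|iota (h x) ord0 j - iota (f x) ord0 j| <= d.
Proof.
move=> k1 p1 d0; have [C C0 HC] := sobolev_dist_sup k1 p1.
(* [C + 1] rather than [C], which may be 0. *)
exists (d / (C + 1)); first by rewrite divr_gt0// ltr_wpDl.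
move=> f h sf [sh hd] x j; rewrite -lee_fin; apply: le_trans (HC f h sf sh x j) _.
apply: (@le_trans _ _ (C%:E * (d / (C + 1))%:E)%E); first by rewrite lee_wpmul2l// ltW.
rewrite -EFinM lee_fin mulrCA; apply: ler_piMr; first exact: ltW.
by rewrite ler_pdivrMr ?ltr_wpDl// mul1r lerDl.
Qed.

End distance.

Theorem theorem1p2 (R : realType) (n : nat) (M : topologicalType)
    (X : riemannian_manifold R n M) (compactM : compact [set: M])
    (m : nat) (iota : M -> 'rV[R]_m) (embed_iota : smooth_embedding X iota)
    (k : nat) (p : R) (p_ge1 : 1 <= p) (kp_gt1 : 1 < k%:R - 2 / p)
    (G : set (PSL2 R)) (groupG : reparam_group G)
    (f : sphere R -> M) (nonconst_f : nonconst_sobolev_maps iota k p f) :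
  exists (eps : R) (K_f : set (PSL2 R)),
    [/\ 0 < eps,
        sobolev_ball iota k p f eps `<=` nonconst_sobolev_maps iota k p,
        compact K_f /\ K_f `<=` G,
        (forall h g, sobolev_ball iota k p f eps h -> (G `\` K_f) g ->
           ~ sobolev_ball iota k p f eps (h \o reparam g)) &
        (forall g, (G `\` K_f) g ->
           ~ sobolev_ball iota k p f eps (f \o reparam g))].
Proof.
have ciota := embedding_continuous embed_iota.
(* Since [2 / p] is positive, the hypothesis forces [k] to exceed 1. *)
have k1 : (1 < k)%N.
  rewrite -(ltr_nat R); have : 0 < 2 / p by rewrite divr_gt0//; lra.
  by move: kp_gt1; lra.
have [sf ncf] := nonconst_f; have [cf _] := sf.
(* The point at infinity serves as base point; injectivity of [iota] makes the nonconstancy of [f]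
   visible in one coordinate. *)
have [x0 [j phij]] : exists x j, iota (f x) ord0 j != iota (f None) ord0 j.
  apply: contrapT => nex; apply: ncf; exists (f None) => x.
  apply: (embedding_inj embed_iota); apply/rowP => j.
  by apply/eqP/negP => /negP xj; apply: nex; exists x, j.
pose phi x := iota (f x) ord0 j : R.
have cphi : continuous phi by exact: coord_map_continuous.
pose D := `|phi x0 - phi None|.
have D0 : 0 < D by rewrite normr_gt0 subr_eq0.
(* Two errors [D / 8] put [f o g] within [r = D / 4] of [f], and [2 * r = D / 2] is still below the
   oscillation [D]. *)
have D8 : 0 < D / 8 by rewrite divr_gt0.
have [eps eps0 close] := sobolev_ball_close ciota k1 p_ge1 D8.
have escape : 2 * (D / 4) < `|phi x0 - phi None| by rewrite -/D; lra.
have [N HN] := proper_mobius cphi escape.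
pose K := @to_PSL2 R @` [set v | [/\ `|v| <= N, \det (cmat v) = 1 & G (to_PSL2 v)]].
(* Stated for uniformly close [h] rather than for the ball, so that it applies to [f] itself without
   computing its distance to itself. *)
have key h g : (forall x, `|iota (h x) ord0 j - phi x| <= D / 8) ->
    (G `\` K) g -> ~ sobolev_ball iota k p f eps (h \o reparam g).
  move=> hclose [Gg nKg] hgball; apply: nKg.
  have [v dv vg] := to_PSL2_surj g; exists v => //; split; rewrite ?vg//.
  apply: HN => // x; rewrite -reparam_to_PSL2// vg.
  have := hclose (reparam g x).
  have := close f _ sf hgball x j; rewrite /= -/(phi x).
  rewrite !ler_norml; lra.
exists eps, K; split => //.
(* A constant [h] in the ball would bring the values of [phi] at [x0] and [None] within [D / 4] of
   each other. *)
- move=> h hball; have [sh _] := hball; split => // -[y hy].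
  have := close f h sf hball x0 j; have := close f h sf hball None j.
  rewrite !hy -/(phi x0) -/(phi None) => h1 h2.
  have := ler_distD (iota y ord0 j) (phi x0) (phi None); rewrite -/D.
  by move: h1 h2; rewrite (distrC _ (phi x0)); lra.
- by split; [exact: compact_reparam_group|move=> _ [v [_ _ Gv] <-]].
- by move=> h g /(close f h sf) hclose; apply: key => x; exact: hclose.
- by move=> g; apply: key => x; rewrite subrr normr0 ltW.
Qed.
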